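(* For all integers $n\ge1$ and all $0<\sigma\le1$, $$\sup_{A\in S^{n^2-1}}\ \mathbf{E}_{Z\in B_{\mathbb{P}}(A,\sigma)}(\ln\kappa_{\mathsf{eigen},\mathbb{R}}(Z))\le 8\ln n+2\ln\frac1\sigma+6.$$
   Context: $\mathbb{R}^{n\times n}$ carries the inner product $(A,B)\mapsto\mathrm{trace}(AB^T)$, with induced Frobenius norm $\|\ \|_F$ and distance $\mathrm{dist}$; $S^{n^2-1}=\{A\in\mathbb{R}^{n\times n}\mid\|A\|_F=1\}$. Let $\Sigma\subseteq\mathbb{R}^{n\times n}$ be the set of real matrices having a real multiple eigenvalue (algebraic multiplicity at least $2$). The condition number of $A$ for real eigenvalue computation is $$\kappa_{\mathsf{eigen},\mathbb{R}}(A):=\frac{\sqrt2\,\|A\|_F}{\mathrm{dist}(A,\Sigma)}$$ (with value $\infty$ if $A\in\Sigma$; for $n=1$ the set $\Sigma$ is empty, the distance is $\infty$, $\kappa_{\mathsf{eigen},\mathbb{R}}=0$ and $\ln 0=-\infty$). $B_{\mathbb{P}}(A,\sigma)$ is the open ball in $S^{n^2-1}$ around $A$ of angular (Riemannian) radius $\arcsin\sigma$, endowed with the uniform probability measure (normalized Riemannian volume of the sphere). *)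

(* Defs.v *)
From HB Require Import structures.
From mathcomp Require Import all_boot all_order all_algebra.
From mathcomp Require Import all_classical all_reals all_analysis.
From mathcomp Require Import measurable_realfun.
Import Order.TTheory GRing.Theory Num.Theory.
Import numFieldNormedType.Exports.

Set Implicit Arguments.
Unset Strict Implicit.
Unset Printing Implicit Defensive.

Local Open Scope classical_set_scope.
Local Open Scope ring_scope.

Lemma measurable_preimageT d d' (T : measurableType d) (U : measurableType d')
    (f : T -> U) (B : set U) :
  measurable_fun setT f -> measurable B -> measurable (f @^-1` B).
Proof. by move=> mf mB; rewrite -[X in measurable X]setTI; exact: mf. Qed.

(* The sigma-algebra on matrices generated by the entries, i.e. the Borel
   sigma-algebra of R^(m x n). *)
Definition mx_display : measure_display.
Proof. exact: default_measure_display. Qed.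

Section mx_measurable.
Variables (R : realType) (m n : nat).

Definition mx_sigma_algebra : set (set 'M[R]_(m, n)) :=
  <<s \bigcup_(ij in [set: 'I_m * 'I_n])
        preimage_set_system setT (fun M : 'M[R]_(m, n) => M ij.1 ij.2)
          measurable >>.

Let mx_sigma_algebra0 : mx_sigma_algebra set0.
Proof. exact: sigma_algebra0. Qed.

Let mx_sigma_algebraC A : mx_sigma_algebra A -> mx_sigma_algebra (~` A).
Proof. exact: sigma_algebraC. Qed.

Let mx_sigma_algebra_bigcup (F : (set 'M[R]_(m, n))^nat) :
  (forall i, mx_sigma_algebra (F i)) -> mx_sigma_algebra (\bigcup_i F i).
Proof. exact: sigma_algebra_bigcup. Qed.

HB.instance Definition _ := @isMeasurable.Build mx_display 'M[R]_(m, n)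
  mx_sigma_algebra mx_sigma_algebra0 mx_sigma_algebraC mx_sigma_algebra_bigcup.

Lemma measurable_mx_entry (i : 'I_m) (j : 'I_n) :
  measurable_fun setT (fun M : 'M[R]_(m, n) => M i j).
Proof.
move=> _ B mB; apply: sub_sigma_algebra; exists (i, j) => //.
by exists B.
Qed.

Lemma measurable_fun_mx d (T : measurableType d) (f : T -> 'M[R]_(m, n)) :
  (forall i j, measurable_fun setT (fun x => f x i j)) ->
  measurable_fun setT f.
Proof.
move=> mf; apply: (@measurability _ _ _ _ _ _
  (\bigcup_(ij in [set: 'I_m * 'I_n])
     preimage_set_system setT (fun M : 'M[R]_(m, n) => M ij.1 ij.2)
       measurable)) => //.
move=> _ [_ [[i j] _ [B mB <-]] <-].
by rewrite !setTI; apply: (measurable_preimageT (mf i j)).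
Qed.

End mx_measurable.

Section lebesgue_rV_step.
Variables (R : realType) (k : nat).
Variable mu : {sigma_finite_measure set 'rV[R]_k -> \bar R}.

Definition cons_rV (p : R * 'rV[R]_k) : 'rV[R]_k.+1 := row_mx p.1%:M p.2.

Definition uncons_rV (v : 'rV[R]_k.+1) : R * 'rV[R]_k :=
  (v 0 0, @rsubmx _ 1 1 k v).

Lemma cons_rVK : cancel cons_rV uncons_rV.
Proof.
move=> [x v]; rewrite /uncons_rV /cons_rV/= row_mxKr; congr pair.
have -> : (0 : 'I_k.+1) = @lshift 1 k 0 by exact/val_inj.
by rewrite (@row_mxEl _ 1 1 k) mxE.
Qed.

Lemma measurable_cons_rV :
  measurable_fun [set: measurableTypeR R * 'rV[R]_k] cons_rV.
Proof.
apply: measurable_fun_mx => i j; rewrite ord1.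
rewrite (_ : (fun _ => _) = fun p : measurableTypeR R * 'rV[R]_k =>
  match @fintype.split 1%N k j with inl _ => p.1 | inr l => p.2 0 l end); last first.
  by apply/funext => p; rewrite mxE; case: split_ordP => l _//; rewrite !mxE ord1 eqxx.
case: fintype.split => l; first exact: measurable_fst.
exact: (measurableT_comp (measurable_mx_entry _ _) measurable_snd).
Qed.

Lemma measurable_uncons_rV :
  measurable_fun setT (uncons_rV : _ -> measurableTypeR R * 'rV[R]_k).
Proof.
apply: measurable_fun_pair; first exact: measurable_mx_entry.
apply: measurable_fun_mx => i j.
rewrite (_ : (fun _ => _) = fun v : 'rV[R]_k.+1 => v i (rshift 1 j)).
  exact: measurable_mx_entry.
by apply/funext => v; rewrite mxE.
Qed.

Definition lebesgue_rV_step : set 'rV[R]_k.+1 -> \bar R :=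
  pushforward (@lebesgue_measure R \x mu)%E cons_rV.

HB.instance Definition _ := Measure.copy lebesgue_rV_step
  (measure_function_pushforward__canonical__measure_function_Measure
    (@lebesgue_measure R \x mu)%E measurable_cons_rV).

Let sigma_finite_lebesgue_rV_step : sigma_finite setT lebesgue_rV_step.
Proof.
have /sigma_finiteP[F [TF ndF Foo]] := sigma_finiteT (@lebesgue_measure R).
have /sigma_finiteP[G [TG ndG Goo]] := sigma_finiteT mu.
exists (fun i => uncons_rV @^-1` (F i `*` G i)).
  rewrite -preimage_bigcup (_ : \bigcup_i _ = setT) ?preimage_setT//.
  rewrite -setXTT TF TG predeqE => -[x y]; split.
    by move=> [i _ []/= ? ?]; split; exists i.
  move=> [/= [i _ Fix] [j _ Gjy]]; exists (maxn i j) => //; split.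
    by move: x Fix; exact/subsetPset/ndF/leq_maxl.
  by move: y Gjy; exact/subsetPset/ndG/leq_maxr.
move=> i; have [mF Fi] := Foo i; have [mG Gi] := Goo i.
split; first exact: (measurable_preimageT measurable_uncons_rV (measurableX mF mG)).
rewrite /lebesgue_rV_step /pushforward -comp_preimage.
rewrite (_ : _ \o _ = id) ?preimage_id; last by apply/funext => x; exact: cons_rVK.
by rewrite product_measure1E// lte_mul_pinfty// ge0_fin_numE.
Qed.

HB.instance Definition _ :=
  Measure_isSigmaFinite.Build _ _ _ lebesgue_rV_step
    sigma_finite_lebesgue_rV_step.

End lebesgue_rV_step.

(* Lebesgue measure on R^k as an iterated product; on R^0 it is the unit mass
   at the only point. *)
Fixpoint lebesgue_rV (R : realType) (k : nat) :
    {sigma_finite_measure set 'rV[R]_k -> \bar R} :=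
  match k with
  | 0%N => \d_(0 : 'rV[R]_0)
  | l.+1 => lebesgue_rV_step (lebesgue_rV R l)
  end.

Section lebesgue_mx.
Variables (R : realType) (m n : nat).

Lemma measurable_vec_mx :
  measurable_fun setT (@vec_mx R m n : 'rV[R]_(m * n) -> 'M[R]_(m, n)).
Proof.
apply: measurable_fun_mx => i j.
rewrite (_ : (fun _ => _) = fun v : 'rV[R]_(m * n) => v 0 (mxvec_index i j)).
  exact: measurable_mx_entry.
by apply/funext => v; rewrite mxE.
Qed.

Definition lebesgue_mx : set 'M[R]_(m, n) -> \bar R :=
  pushforward (lebesgue_rV R (m * n)) vec_mx.

HB.instance Definition _ := Measure.copy lebesgue_mx
  (measure_function_pushforward__canonical__measure_function_Measure
    (lebesgue_rV R (m * n)) measurable_vec_mx).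

End lebesgue_mx.

Lemma measurable_acos (R : realType) : measurable_fun setT (@acos R).
Proof.
rewrite -(setvU `[(-1), 1]%classic); apply/measurable_funU => //.
  exact: measurableC.
split; last first.
  apply: (@measurable_fun_itv_cc _ _ _ false true).
  apply: open_continuous_measurable_fun => //.
  by move=> x; rewrite inE/= in_itv/=; exact: continuous_acos.
apply: (@eq_measurable_fun _ _ _ _ _ (cst point)) => // x.
rewrite inE/= in_itv/= => x1; rewrite unlock xgetPN// => y [_ xE]; apply: x1.
by rewrite -xE cos_geN1 cos_le1.
Qed.

Section frobenius.
Variables (R : realType) (n : nat).
Implicit Types A B M Z : 'M[R]_n.

Definition frob_inner A B : R := \tr (A *m B^T).

Definition frob_norm A : R := Num.sqrt (frob_inner A A).

(* The norm the library puts on matrices is the max norm, hence the explicit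
   Frobenius norm here.  The distance to the empty set is +oo. *)
Definition frob_dist A (S : set 'M[R]_n) : \bar R :=
  ereal_inf [set (frob_norm (A - B))%:E | B in S].

Definition frob_sphere : set 'M[R]_n := [set A | frob_norm A = 1].

(* Meaningful for points of the sphere only: the library's acos is a constant
   outside [-1, 1]. *)
Definition angle A B : R := acos (frob_inner A B).

Definition sphere_ball A (sigma : R) : set 'M[R]_n :=
  [set Z | frob_sphere Z /\ angle A Z < asin sigma].

Lemma measurable_frob_inner d (T : measurableType d) (f g : T -> 'M[R]_n) :
  measurable_fun setT f -> measurable_fun setT g ->
  measurable_fun setT (fun x => frob_inner (f x) (g x)).
Proof.
move=> mf mg; apply: measurable_sum => i.
rewrite (_ : (fun _ => _) = fun x => \sum_j f x i j * g x i j).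
  apply: measurable_sum => j; apply: measurable_funM.
    exact: (measurableT_comp (measurable_mx_entry i j) mf).
  exact: (measurableT_comp (measurable_mx_entry i j) mg).
by apply/funext => x; rewrite mxE; apply: eq_bigr => j _; rewrite mxE.
Qed.

Lemma measurable_frob_norm : measurable_fun setT frob_norm.
Proof.
apply: (@measurableT_comp _ _ _ _ _ _ (@Num.sqrt R)).
  exact: continuous_measurable_fun (@sqrt_continuous R).
by apply: measurable_frob_inner; exact: measurable_id.
Qed.

Lemma measurable_sphere_ball A sigma : measurable (sphere_ball A sigma).
Proof.
apply: measurableI.
  by apply: (measurable_preimageT measurable_frob_norm (measurable_set1 1)).
have mangle : measurable_fun setT (angle A).
  apply: (@measurableT_comp _ _ _ _ _ _ (@acos R) _ (frob_inner A)).
    exact: measurable_acos.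
  apply: measurable_frob_inner; last exact: measurable_id.
  exact: measurable_cst.
rewrite [X in measurable X](_ : _ = angle A @^-1` `]-oo, asin sigma[).
  exact: (measurable_preimageT mangle).
by apply/seteqP; split => Z; rewrite /preimage/= in_itv.
Qed.

Definition punctured_ball : set 'M[R]_n := [set M | 0 < frob_norm M <= 1].

Lemma measurable_punctured_ball : measurable punctured_ball.
Proof.
rewrite [X in measurable X](_ : _ = frob_norm @^-1` `]0, 1]).
  exact: (measurable_preimageT measurable_frob_norm).
by apply/seteqP; split => Z; rewrite /preimage/= in_itv.
Qed.

Definition sphere_proj M : 'M[R]_n := (frob_norm M)^-1 *: M.

Lemma measurable_sphere_proj : measurable_fun setT sphere_proj.
Proof.
apply: measurable_fun_mx => i j.
rewrite (_ : (fun _ => _) = fun M : 'M[R]_n => (frob_norm M)^-1 * M i j).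
  apply: measurable_funM; last exact: measurable_mx_entry.
  rewrite (_ : (fun _ => _) = fun M : 'M[R]_n => frob_norm M `^ -1).
    apply: (@measurableT_comp _ _ _ _ _ _ (@powR R ^~ (-1)) _ frob_norm).
      exact: measurable_powR.
    exact: measurable_frob_norm.
  by apply/funext => M; rewrite powR_inv1// sqrtr_ge0.
by apply/funext => M; rewrite mxE.
Qed.

(* The Riemannian volume of the unit sphere of R^(n x n), through integration
   in polar coordinates: in dimension N = n^2 the cone
   { t *: Z | 0 < t <= 1, Z in E } over a subset E of the sphere has Lebesgue
   measure vol(E) / N (the integral of t^(N-1) dt over [0, 1] being 1 / N).
   For n = 1 this is the counting measure on {1, -1}. *)
Definition sphere_volume (E : set 'M[R]_n) : \bar R :=
  ((n ^ 2)%:R%:E *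
   lebesgue_mx [set M | punctured_ball M /\ E (sphere_proj M)])%E.

Lemma sphere_volumeE E :
  sphere_volume E = mscale ((n ^ 2)%:R%:nng : {nonneg R})
    (measure_function_pushforward__canonical__measure_function_Measure
      (mrestr (@lebesgue_mx R n n) measurable_punctured_ball)
      measurable_sphere_proj) E.
Proof.
rewrite /sphere_volume /mscale/= /pushforward /mrestr setIC.
reflexivity.
Qed.

Let sphere_volume0 : sphere_volume set0 = 0%E.
Proof. by rewrite sphere_volumeE measure0. Qed.

Let sphere_volume_ge0 E : (0 <= sphere_volume E)%E.
Proof. by rewrite sphere_volumeE. Qed.

Let sphere_volume_sigma_additive : semi_sigma_additive sphere_volume.
Proof.
by rewrite (funext sphere_volumeE); exact: measure_semi_sigma_additive.
Qed.

HB.instance Definition _ := isMeasure.Build _ _ _ sphere_volume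
  sphere_volume0 sphere_volume_ge0 sphere_volume_sigma_additive.

(* The normalized restriction of the volume to the ball.  The Dirac mass is the
   default value of mnormalize when the total mass is zero or infinite, which
   does not happen if A lies on the sphere and 0 < sigma <= 1. *)
Definition uniform_ball A (sigma : R) : probability 'M[R]_n R :=
  mnormalize (mrestr sphere_volume (measurable_sphere_ball A sigma)) \d_A.

Definition multiple_eigen : set 'M[R]_n :=
  [set A | exists x : R, (2 <= mup x (char_poly A))%N].

(* If multiple_eigen is empty (n = 1) the distance is +oo and the quotient of
   extended reals is 0, whose logarithm lne is -oo. *)
Definition kappa_eigen A : \bar R :=
  if A \in multiple_eigen then +oo%E
  else ((Num.sqrt 2 * frob_norm A)%:E / frob_dist A multiple_eigen)%E.

End frobenius.

(* Main.v *)
(** The discriminant [f] of the characteristic polynomial is a homogeneous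
    polynomial of degree [d = n (n - 1)] in the entries, and it vanishes on
    [multiple_eigen].  Let [c_k (Z, a)] be the coefficient of [t ^ k] in
    [f (Z + t a)].  If [f] vanishes at distance [e] from [Z] in the unit
    direction [u], then [|c_k (Z, u) / c_0| >= (2 e) ^ - k] for some
    [1 <= k <= d].

    The direction [u] depends on [Z], but the restriction of [c_k (Z, -)] to a
    segment parallel to [u] is a polynomial of degree [k] with leading
    coefficient proportional to [c_k (Z, u)], hence is not small on average.
    So [- ln e] is bounded by the mean over all [a] in the unit ball of
    [max_k (1 / k) ln |c_k (Z, a) / c_0|].  For a fixed [a], this maximum is
    large only if [Z] is close to one of the [d] complex roots of [f] on the
    line of direction [a] through [Z]; along that line this happens with small
    probability.

    The mean over a line is turned into a mean over a convex body (the unit ball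
    or the cone over the spherical cap) by contracting the body by the factor
    [k = N / (N + 1)], [N = n ^ 2], and translating it by small multiples of the
    direction: this uses only translations and homotheties of the Lebesgue
    measure and costs the factor [k ^ - N <= e]. *)
Require Import Defs.
From HB Require Import structures.
From mathcomp Require Import all_boot all_order all_algebra.
From mathcomp Require Import all_classical all_reals all_analysis.
From mathcomp Require Import measurable_realfun perm complex ring lra.
Import Order.TTheory GRing.Theory Num.Theory.
Import numFieldNormedType.Exports.

Set Implicit Arguments.
Unset Strict Implicit.
Unset Printing Implicit Defensive.

Local Open Scope classical_set_scope.
Local Open Scope ring_scope.

(** * Homogeneous forms restricted to lines *)

Section forms.
Variables (R : comNzRingType) (J : Type).
Implicit Types (x y z : J -> R) (s : seq J) (F : seq (R * seq J)).

(** A monomial is encoded as the list of its variables with repetitions, and a form as a list of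
    coefficients and monomials. This is the restriction of a monomial to the line through [x] with
    direction [y]. *)
Definition monomial_line s x y : {poly R} :=
  \prod_(j <- s) ((x j)%:P + y j *: 'X).

Definition form_line F x y : {poly R} :=
  \sum_(m <- F) m.1 *: monomial_line m.2 x y.

Definition form_eval F x : R := \sum_(m <- F) m.1 * \prod_(j <- m.2) x j.

Definition form_degree d F := all (fun m => size m.2 == d) F.

Lemma monomial_line_cons j s x y :
  monomial_line (j :: s) x y = ((x j)%:P + y j *: 'X) * monomial_line s x y.
Proof. by rewrite /monomial_line big_cons. Qed.

Lemma coef_linear_mul (a b : R) (p : {poly R}) k :
  ((a%:P + b *: 'X) * p)`_k = a * p`_k + b * (if k is l.+1 then p`_l else 0).
Proof.
rewrite mulrDl coefD coefCM -scalerAl coefZ coefXM.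
by case: k.
Qed.

Lemma size_monomial_line s x y : (size (monomial_line s x y) <= (size s).+1)%N.
Proof.
apply/leq_sizeP; elim: s => [|j s IH] k /=.
  by rewrite /monomial_line big_nil coef1; case: k.
case: k => // k sk; rewrite monomial_line_cons coef_linear_mul !IH ?mulr0 ?addr0//.
exact: ltnW.
Qed.

Lemma monomial_line_lead s x y :
  (monomial_line s x y)`_(size s) = \prod_(j <- s) y j.
Proof.
elim: s => [|j s IH] /=; first by rewrite /monomial_line !big_nil coef1.
rewrite monomial_line_cons coef_linear_mul IH big_cons.
by rewrite (leq_sizeP _ _ (size_monomial_line s x y))// mulr0 add0r.
Qed.

Lemma horner_monomial_line s x y t :
  (monomial_line s x y).[t] = \prod_(j <- s) (x j + t * y j).
Proof.
rewrite /monomial_line horner_prod; apply: eq_bigr => j _.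
by rewrite !hornerE mulrC.
Qed.

(** The coefficient of ['X^k] takes the constant term of exactly [size s - k] factors, and each of
    these yields one [l]. *)
Lemma monomial_line_scale s x y (l : R) k : (k <= size s)%N ->
  (monomial_line s (fun j => l * x j) y)`_k =
  l ^+ (size s - k) * (monomial_line s x y)`_k.
Proof.
elim: s k => [|j s IH] k /=.
  by rewrite leqn0 => /eqP ->; rewrite /monomial_line !big_nil expr0 mul1r.
move=> ks; rewrite !monomial_line_cons !coef_linear_mul mulrDr.
congr (_ + _).
  have [ks'|] := leqP k (size s).
    by rewrite IH// subSn// exprS; ring.
  by move=> sk; rewrite !(leq_sizeP _ _ (size_monomial_line s _ _))// !mulr0.
case: k ks => [|k] ks; first by rewrite !mulr0.
by rewrite IH// subSS; ring.
Qed.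

(** The coefficient of ['X^k] takes [k] factors from the direction. Along the line [b + t w] of
    directions it is therefore a polynomial of degree at most [k] in [t], whose top coefficient only
    sees [w]. *)
Lemma monomial_line_poly s x b w k :
  exists q : {poly R}, [/\ (size q <= k.+1)%N, q`_k = (monomial_line s x w)`_k &
    forall t, q.[t] = (monomial_line s x (fun j => b j + t * w j))`_k].
Proof.
elim: s k => [|j s IH] k.
  exists (k == 0%N)%:R%:P; rewrite /monomial_line !big_nil; split.
  - by rewrite (leq_trans (size_polyC_leq1 _)).
  - by rewrite coefC coef1; case: k.
  - by move=> t; rewrite hornerC big_nil coef1.
have [q [qs qk qt]] := IH k.
case: k q qs qk qt => [|k] q qs qk qt.
  exists (x j *: q); split.
  - by rewrite (leq_trans (size_scale_leq _ _)).
  - by rewrite coefZ monomial_line_cons coef_linear_mul mulr0 addr0 qk.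
  - move=> t; rewrite monomial_line_cons coef_linear_mul mulr0 addr0.
    by rewrite hornerZ qt.
have [p [ps pk pt]] := IH k.
exists (x j *: q + ((b j)%:P + w j *: 'X) * p); split.
- apply/leq_sizeP => l kl; rewrite coefD coefZ coef_linear_mul.
  rewrite (leq_sizeP _ _ qs)// (leq_sizeP _ _ ps) ?(ltnW kl)//.
  case: l kl => // l kl; rewrite (leq_sizeP _ _ ps)//; ring.
- rewrite coefD coefZ monomial_line_cons !coef_linear_mul qk pk.
  by rewrite (leq_sizeP _ _ ps)//; ring.
- move=> t; rewrite monomial_line_cons coef_linear_mul !hornerE qt pt.
  by ring.
Qed.

Lemma coef_form_line F x y k :
  (form_line F x y)`_k = \sum_(m <- F) m.1 * (monomial_line m.2 x y)`_k.
Proof. by rewrite /form_line coef_sum; apply: eq_bigr => m _; rewrite coefZ. Qed.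


Lemma size_form_line d F x y : form_degree d F ->
  (size (form_line F x y) <= d.+1)%N.
Proof.
elim: F => [|m F IH] /=; first by rewrite /form_line big_nil size_poly0.
move=> /andP[/eqP md /IH Fd]; rewrite /form_line big_cons.
rewrite (leq_trans (size_polyD _ _))// geq_max Fd andbT.
by rewrite (leq_trans (size_scale_leq _ _))// -md size_monomial_line.
Qed.

Lemma form_line_lead d F x y : form_degree d F ->
  (form_line F x y)`_d = form_eval F y.
Proof.
rewrite coef_form_line /form_eval; elim: F => [|m F IH] /=; first by rewrite !big_nil.
by move=> /andP[/eqP md /IH Fd]; rewrite !big_cons Fd -md monomial_line_lead.
Qed.

Lemma horner_form_line F x y t :
  (form_line F x y).[t] = form_eval F (fun j => x j + t * y j).
Proof.
rewrite /form_line /form_eval horner_sum; apply: eq_bigr => m _.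
by rewrite hornerZ horner_monomial_line.
Qed.

Lemma form_line0 F x y : (form_line F x y)`_0 = form_eval F x.
Proof.
rewrite -horner_coef0 horner_form_line; congr form_eval.
by apply/funext => j; rewrite mul0r addr0.
Qed.

(** Moving the base point along the line is a Taylor shift, so the coefficients at every point of
    the line come from one polynomial. *)
Lemma form_line_shift F x y t :
  form_line F (fun j => x j + t * y j) y = form_line F x y \Po ('X + t%:P).
Proof.
rewrite /form_line rmorph_sum/=; apply: eq_bigr => m _.
rewrite linearZ/=; congr (_ *: _); rewrite /monomial_line rmorph_prod/=.
apply: eq_bigr => j _; rewrite comp_polyD comp_polyC comp_polyZ comp_polyX.
by rewrite scalerDr polyCD polyCM -!mul_polyC; ring.
Qed.

Lemma form_line_scale d F x y (l : R) k : form_degree d F -> (k <= d)%N ->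
  (form_line F (fun j => l * x j) y)`_k = l ^+ (d - k) * (form_line F x y)`_k.
Proof.
rewrite !coef_form_line => Fd kd.
elim: F Fd => [|m F IH] /=; first by rewrite !big_nil mulr0.
move=> /andP[/eqP md /IH Fd]; rewrite !big_cons Fd -md monomial_line_scale ?md//.
by ring.
Qed.

Lemma form_line_poly F x b w k :
  exists q : {poly R}, [/\ (size q <= k.+1)%N, q`_k = (form_line F x w)`_k &
    forall t, q.[t] = (form_line F x (fun j => b j + t * w j))`_k].
Proof.
elim: F => [|m F [q [qs qk qt]]].
  exists 0; split; rewrite ?size_poly0 /form_line ?big_nil ?coef0// => t.
  by rewrite hornerC big_nil coef0.
have [p [ps pk pt]] := monomial_line_poly m.2 x b w k.
exists (m.1 *: p + q); split.
- rewrite (leq_trans (size_polyD _ _))// geq_max qs andbT.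
  by rewrite (leq_trans (size_scale_leq _ _)).
- by rewrite coefD coefZ pk qk !coef_form_line big_cons.
- by move=> t; rewrite hornerD hornerZ pt qt !coef_form_line big_cons.
Qed.

Definition homogeneous d (g : (J -> R) -> R) :=
  exists2 F, form_degree d F & forall x, g x = form_eval F x.

Lemma homogeneous_var j : homogeneous 1 (fun x => x j).
Proof.
by exists [:: (1, [:: j])] => // x; rewrite /form_eval !big_seq1 mul1r.
Qed.

Lemma homogeneous_cst c : homogeneous 0 (fun=> c).
Proof.
by exists [:: (c, [::])] => // x; rewrite /form_eval big_seq1 big_nil mulr1.
Qed.

Lemma homogeneous0 d : homogeneous d (fun=> 0).
Proof. by exists [::] => // x; rewrite /form_eval big_nil. Qed.

Lemma homogeneousD d g h : homogeneous d g -> homogeneous d h ->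
  homogeneous d (fun x => g x + h x).
Proof.
move=> [F Fd gF] [G Gd hG]; exists (F ++ G).
  by rewrite /form_degree all_cat; apply/andP.
by move=> x; rewrite gF hG /form_eval big_cat.
Qed.

Lemma homogeneousM d e g h : homogeneous d g -> homogeneous e h ->
  homogeneous (d + e)%N (fun x => g x * h x).
Proof.
move=> [F Fd gF] [G Gd hG].
exists [seq (m.1 * m'.1, m.2 ++ m'.2) | m <- F, m' <- G].
  have FG (m : R * seq J) : size m.2 == d ->
      form_degree (d + e)%N [seq (m.1 * m'.1, m.2 ++ m'.2) | m' <- G].
    move=> /eqP md; elim: G Gd {hG} => //= m' G IH /andP[/eqP m'd /IH ->].
    by rewrite size_cat md m'd eqxx.
  elim: F Fd {gF} => //= m F IH /andP[/FG mG /IH FG'].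
  by rewrite /form_degree all_cat; apply/andP.
move=> x; rewrite gF hG /form_eval big_allpairs_dep/= big_distrl/=.
apply: eq_bigr => m _; rewrite big_distrr/=; apply: eq_bigr => m' _.
by rewrite big_cat/=; ring.
Qed.

Lemma homogeneous_sum (I : Type) (r : seq I) (P : pred I) d
    (g : I -> (J -> R) -> R) : (forall i, homogeneous d (g i)) ->
  homogeneous d (fun x => \sum_(i <- r | P i) g i x).
Proof.
move=> gd; elim: r => [|i r IH].
  rewrite (_ : (fun _ => _) = fun=> 0); first exact: homogeneous0.
  by apply/funext => x; rewrite big_nil.
rewrite (_ : (fun _ => _) = if P i then
    fun x => g i x + \sum_(i <- r | P i) g i x
  else fun x => \sum_(i <- r | P i) g i x).
  by case: ifP => // _; exact: homogeneousD.
by apply/funext => x; rewrite big_cons; case: ifP.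
Qed.

Lemma homogeneous_prod (I : Type) (r : seq I) (e : I -> nat)
    (g : I -> (J -> R) -> R) : (forall i, homogeneous (e i) (g i)) ->
  homogeneous (\sum_(i <- r) e i) (fun x => \prod_(i <- r) g i x).
Proof.
move=> gd; elim: r => [|i r IH].
  rewrite big_nil (_ : (fun _ => _) = fun=> 1); first exact: homogeneous_cst.
  by apply/funext => x; rewrite big_nil.
rewrite big_cons (_ : (fun _ => _) =
  fun x => g i x * \prod_(i <- r) g i x); first exact: homogeneousM.
by apply/funext => x; rewrite big_cons.
Qed.

End forms.

(** * The discriminant of the characteristic polynomial *)

Section trace_discriminant.
Variables (R : comNzRingType) (n : nat).
Implicit Types A : 'M[R]_n.+1.

(* Over an algebraically closed field, the determinant is the square of the
   Vandermonde determinant of the eigenvalues: the discriminant of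
   [char_poly A]. *)
Definition trace_gram A : 'M[R]_n.+1 := \matrix_(i, j) \tr (A ^+ (i + j)).

Definition trace_disc A : R := \det (trace_gram A).

Definition mx_of_entries (x : 'I_n.+1 * 'I_n.+1 -> R) : 'M[R]_n.+1 :=
  \matrix_(i, j) x (i, j).

Lemma homogeneous_mx_expr k i j :
  homogeneous k (fun x => (mx_of_entries x ^+ k) i j).
Proof.
elim: k i j => [|k IH] i j.
  rewrite (_ : (fun _ => _) = fun=> (i == j)%:R); first exact: homogeneous_cst.
  by apply/funext => x; rewrite expr0 !mxE.
rewrite (_ : (fun _ => _) = fun x =>
    \sum_l mx_of_entries x i l * (mx_of_entries x ^+ k) l j).
  apply: homogeneous_sum => l; apply: (@homogeneousM _ _ 1) => //.
  rewrite (_ : (fun _ => _) = fun x => x (i, l)); first exact: homogeneous_var.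
  by apply/funext => x; rewrite mxE.
by apply/funext => x; rewrite exprS mxE.
Qed.

(** In the Leibniz expansion the factor at [(i, s i)] has degree [i + s i], and these degrees add up
    to twice the sum of all [i], whatever the permutation [s]. *)
Lemma homogeneous_trace_disc :
  homogeneous (n.+1 * n)%N (fun x => trace_disc (mx_of_entries x)).
Proof.
rewrite /trace_disc /determinant; apply: homogeneous_sum => s.
rewrite -[(_ * n)%N]add0n; apply: homogeneousM; first exact: homogeneous_cst.
have -> : (n.+1 * n = \sum_(i < n.+1) (i + s i))%N.
  rewrite big_split/=.
  have <- : (\sum_(i < n.+1) i = \sum_(i < n.+1) s i)%N.
    by rewrite [LHS](reindex_perm s).
  by rewrite addnn -mul2n -(big_mkord xpredT id)/= bin2_sum -mul_bin_diag bin1.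
apply: homogeneous_prod => i.
rewrite (_ : (fun _ => _) = fun x =>
    \sum_k (mx_of_entries x ^+ (i + s i)) k k).
  by apply: homogeneous_sum => k; exact: homogeneous_mx_expr.
by apply/funext => x; rewrite mxE.
Qed.

End trace_discriminant.

Section trace_discriminant_theory.
Variables (F : fieldType) (n : nat).
Implicit Types A X : 'M[F]_n.+1.

(** In the rank factorization [X = col_base X *m row_base X], the outer factors of [X * X] can be
    cancelled, so [row_base X *m col_base X] is 0. By cyclicity it has the trace of [X]. *)
Lemma mxtrace_sqr0 X : X * X = 0 -> \tr X = 0.
Proof.
move=> XX0; rewrite -(mulmx_base X) mxtrace_mulC.
suff -> : row_base X *m col_base X = 0 by rewrite mxtrace0.
apply: (row_full_inj (col_base_full X)); apply: (row_free_inj (row_base_free X)).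
by rewrite mulmx0 mul0mx mulmxA -mulmxA !mulmx_base.
Qed.

(* For g = char_poly A / ('X - x), g(A)^2 = 0 by Cayley-Hamilton, so every
   g(A) A^j has trace 0: the coefficients of g are in the kernel of the Gram
   matrix. *)
Lemma trace_disc_eq0 A x : (2 <= mup x (char_poly A))%N -> trace_disc A = 0.
Proof.
have pm := char_poly_monic A.
rewrite mup_geq ?monic_neq0// => /dvdpP[q pE].
pose g := q * ('X - x%:P).
have pgE : char_poly A = g * ('X - x%:P) by rewrite pE /g expr2 mulrA.
have g0 : g != 0.
  by apply: contra_eq_neq pgE => ->; rewrite mul0r monic_neq0.
have sg : size g = n.+1.
  have := size_char_poly A; rewrite pgE size_Mmonic ?monicXsubC//.
  by rewrite size_XsubC addn2 => -[].
have gA0 : horner_mx A g * horner_mx A g = 0.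
  (* Squaring [g] restores the double factor, so [g * g] is a multiple of the characteristic
     polynomial. *)
  rewrite -rmorphM (_ : g * g = q * char_poly A); last by rewrite pE /g; ring.
  by rewrite rmorphM/= Cayley_Hamilton mulr0.
apply/eqP/det0P; exists (\row_i g`_i).
  apply: contra_neq g0 => /rowP g0; apply/polyP => i.
  have [ilt|] := ltnP i n.+1.
    by have := g0 (Ordinal ilt); rewrite !mxE coef0.
  by move=> igt; rewrite nth_default ?sg// coef0.
apply/rowP => j; rewrite !mxE.
under eq_bigr do rewrite !mxE -mxtraceZ.
rewrite -raddf_sum/=; transitivity (\tr (horner_mx A (g * 'X^j))); last first.
  apply: mxtrace_sqr0.
  rewrite -rmorphM mulrACA rmorphM/= (rmorphM _ g)/=.
  by rewrite gA0 mul0r.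
congr (\tr _); rewrite rmorphM/= rmorphXn/= horner_mx_X.
rewrite -[in RHS](coefK g) poly_def rmorph_sum/= mulr_suml sg.
apply: eq_bigr => i _.
by rewrite linearZ/= rmorphXn/= horner_mx_X -scalerAl -exprD.
Qed.

(** The entries of the Gram matrix are the power sums of [d], so it is the Vandermonde matrix times
    its transpose. *)
Lemma trace_disc_diag (d : 'rV[F]_n.+1) :
  trace_disc (diag_mx d) = \det (Vandermonde n.+1 d) ^+ 2.
Proof.
rewrite expr2 -[X in _ * X]det_tr -det_mulmx; congr (\det _).
apply/matrixP => i j; rewrite !mxE.
have -> (k : nat) : diag_mx d ^+ k = diag_mx (\row_l d 0 l ^+ k).
  rewrite -[diag_mx d in LHS]horner_mx_X -rmorphXn/= horner_mx_diag.
  by congr diag_mx; apply/rowP => l; rewrite !mxE hornerXn.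
rewrite mxtrace_diag; apply: eq_bigr => l _.
by rewrite !mxE exprD.
Qed.

End trace_discriminant_theory.

(** The eigenvalues 0, ..., n are distinct. This witness shows that the discriminant form does not
    vanish identically. *)
Lemma trace_disc_neq0 (R : realFieldType) n :
  trace_disc (diag_mx (\row_(i < n.+1) i%:R : 'rV[R]_n.+1)) != 0.
Proof.
rewrite trace_disc_diag expf_neq0// det_Vandermonde.
apply/prodf_neq0 => i _; apply/prodf_neq0 => j ij.
by rewrite !mxE subr_eq0 eqr_nat gtn_eqF.
Qed.

Lemma trace_disc_form (R : comNzRingType) n :
  exists2 F : seq (R * seq ('I_n.+1 * 'I_n.+1)), form_degree (n.+1 * n)%N F &
    forall A, trace_disc A = form_eval F (fun p => A p.1 p.2).
Proof.
have [F Fd FE] := homogeneous_trace_disc R n.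
exists F => // A; rewrite -FE; congr trace_disc.
by apply/matrixP => i j; rewrite mxE.
Qed.

(** * Real parts of the roots of a real polynomial *)

(** Up to sign the coefficient is a sum of ['C(size zs, k)] products of all roots but [k], and
    leaving out a root of modulus at least [r] costs at most a factor [1 / r]. The induction follows
    Pascal's rule. *)
Lemma coef_prod_XsubC_le (K : numFieldType) (zs : seq K) (r : K) (k : nat) :
  0 < r -> (forall z, z \in zs -> r <= `|z|) ->
  `|(\prod_(z <- zs) ('X - z%:P))`_k| * r ^+ k <=
  'C(size zs, k)%:R * `|(\prod_(z <- zs) ('X - z%:P))`_0|.
Proof.
move=> r0; elim: zs k => [|z zs IH] k rz.
  rewrite big_nil !coef1; case: k => [|k]; first by rewrite expr0 bin0 mul1r mulr1.
  by rewrite normr0 mul0r/= mulr_ge0.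
have {}IH l : `|(\prod_(z <- zs) ('X - z%:P))`_l| * r ^+ l <=
    'C(size zs, l)%:R * `|(\prod_(z <- zs) ('X - z%:P))`_0|.
  by apply: IH => w wzs; apply: rz; rewrite inE wzs orbT.
have {}rz : r <= `|z| by apply: rz; rewrite inE eqxx.
set q := \prod_(z <- zs) _ in IH *.
have qk l : (\prod_(j <- z :: zs) ('X - j%:P))`_l =
    (if l is l'.+1 then q`_l' else 0) - z * q`_l.
  by rewrite big_cons mulrBl coefB coefXM coefCM; case: l.
rewrite !qk sub0r normrN normrM.
case: k => [|k]; first by rewrite sub0r normrN normrM expr0 bin0 mulr1 mul1r.
rewrite /= binS natrD mulrDl [leRHS]addrC.
apply: (@le_trans _ _ ((`|q`_k| + `|z| * `|q`_k.+1|) * r ^+ k.+1)).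
  apply: ler_wpM2r; first by rewrite exprn_ge0// ltW.
  by rewrite (le_trans (ler_normB _ _))// normrM.
rewrite mulrDl lerD//.
  rewrite exprS mulrCA [leRHS]mulrCA; apply: ler_pM => //; first exact: ltW.
  by rewrite mulr_ge0// exprn_ge0 ?ltW.
by rewrite -mulrA [leRHS]mulrCA; exact: ler_wpM2l.
Qed.

Section real_poly_roots.
Local Open Scope complex_scope.

(* The x_j are the real parts of the complex roots of p. *)
Lemma real_poly_roots (R : realType) (p : {poly R}) : p != 0 ->
  exists xs : seq R, [/\ size xs = (size p).-1,
    (forall s, `|lead_coef p| * \prod_(x <- xs) `|s - x| <= `|p.[s]|) &
    (forall s r k, 0 < r -> (forall x, x \in xs -> r <= `|s - x|) ->
      `|(p \Po ('X + s%:P))`_k| * r ^+ k <= 'C(size xs, k)%:R * `|p.[s]|)].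
Proof.
move=> p0; pose toC : {rmorphism R -> R[i]} := real_complex R; pose P := map_poly toC p.
have le_toC x y : (toC x <= toC y) = (x <= y) by exact: lecR.
have [zs PE] := closed_field_poly_normal P.
have P0 : lead_coef P != 0 by rewrite lead_coef_map_eq ?fmorph_eq0 ?lead_coef_eq0.
have lP : lead_coef P = toC (lead_coef p) by rewrite lead_coef_map.
have szs : size zs = (size p).-1.
  have : size P = size p by rewrite size_map_poly.
  by rewrite PE size_scale// size_prod_XsubC => <-.
have normC x : `|toC x| = toC `|x|.
  by rewrite normc_def/= expr0n addr0 sqrtr_sqr.
(* Seen from a real point, a root is at least as far away as its real part. Both estimates rest on
   this. *)
have Re_le (z : R[i]) s : toC `|s - complex.Re z| <= `|toC s - z|.
  by have := normc_ge_Re (toC s - z); rewrite raddfB.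
have hornerP s : toC `|p.[s]| = `|P.[toC s]| by rewrite -normC horner_map.
exists (map (@complex.Re R) zs); rewrite size_map; split=> //.
  move=> s; rewrite -le_toC hornerP PE hornerZ normrM lP normC rmorphM/=.
  rewrite horner_prod normr_prod big_map rmorph_prod/=.
  rewrite ler_wpM2l ?ler0c//; elim: zs {PE szs} => [|z zs IH].
    by rewrite !big_nil.
  rewrite !big_cons; apply: ler_pM => //; rewrite ?hornerE.
  - by rewrite ler0c.
  - by apply: prodr_ge0 => w _; rewrite ler0c.
  - exact: Re_le.
move=> s r k r0 rx.
have := @coef_prod_XsubC_le _ [seq z - toC s | z <- zs] (toC r) k.
rewrite size_map big_map.
(* Recentring at [s] moves the roots to [z - s], whose moduli are at least [r] by [Re_le]. *)
have -> : \prod_(z <- zs) ('X - (z - toC s)%:P) =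
    (lead_coef P)^-1 *: (P \Po ('X + (toC s)%:P)).
  rewrite [X in _ *: (X \Po _)]PE comp_polyZ scalerA mulVf// scale1r.
  rewrite rmorph_prod/=; apply: eq_bigr => z _.
  by rewrite comp_polyB comp_polyX comp_polyC polyCB; ring.
have rz z : z \in [seq z - toC s | z <- zs] -> toC r <= `|z|.
  move=> /mapP[w wzs ->]; rewrite distrC (le_trans _ (Re_le w s))// le_toC.
  by apply: rx; apply/mapP; exists w.
rewrite (_ : (0 < toC r) = (0 < r)); last exact: ltcR.
move=> /(_ r0 rz).
rewrite !coefZ !normrM -!mulrA [leRHS]mulrCA ler_pM2l ?normr_gt0 ?invr_eq0//.
rewrite -horner_coef0 horner_comp !hornerE -hornerP.
have -> : P \Po ('X + (toC s)%:P) = map_poly toC (p \Po ('X + s%:P)).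
  by rewrite map_comp_poly rmorphD/= map_polyX map_polyC.
rewrite coef_map/= normC -rmorphXn -rmorphM/=.
by rewrite -(rmorph_nat toC) -rmorphM le_toC.
Qed.

End real_poly_roots.

(** * A logarithmic singularity on the line *)

Section log_bump.
Variable R : realType.
Notation leb := (@lebesgue_measure R).
Local Open Scope ereal_scope.

(* Equal to max(0, ln (b / |x|)), and to +oo at x = 0. *)
Definition log_bump (b x : R) : \bar R :=
  leb [set y | (0 <= y)%R /\ (`|x| <= b * expR (- y))%R].

Lemma log_bump_ge (b x : R) : (0 < b)%R -> x != 0%R ->
  (ln (b / `|x|))%:E <= log_bump b x.
Proof.
move=> b0 x0; have [l0|l0] := leP (ln (b / `|x|)) 0%R.
  by rewrite (@le_trans _ _ 0)// measure_ge0.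
have x1 : (0 < b / `|x|)%R by rewrite divr_gt0// normr_gt0.
rewrite /log_bump (_ : [set y | _ /\ _] = `[0%R, ln (b / `|x|)]%classic).
  by rewrite lebesgue_measure_itv/= lte_fin l0 oppr0 adde0.
apply/seteqP; split => y /=; rewrite in_itv/=.
  move=> [-> yb] /=; rewrite -ler_expR lnK ?posrE// ler_pdivlMr ?normr_gt0//.
  by rewrite mulrC -ler_pdivlMr ?expR_gt0// -expRN.
move=> /andP[-> yb]; split => //.
rewrite expRN ler_pdivlMr ?expR_gt0// mulrC -ler_pdivlMr ?normr_gt0//.
by rewrite -ler_ln ?posrE ?expR_gt0// expRK.
Qed.

Lemma log_bump0 (b : R) : (0 < b)%R -> log_bump b 0 = +oo.
Proof.
move=> b0; rewrite /log_bump (_ : [set y | _] = `[0%R, +oo[%classic).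
  by rewrite lebesgue_measure_itv/= ltry.
apply/seteqP; split => y /=; rewrite in_itv/= andbT; first by case.
by move=> y0; split => //; rewrite normr0 mulr_ge0 ?expR_ge0// ltW.
Qed.

Let E (b x0 : R) : set (measurableTypeR R * measurableTypeR R) :=
  [set z | (0 <= z.2)%R /\ (`|z.1 - x0| <= b * expR (- z.2))%R].

Let mE b x0 : measurable (E b x0).
Proof.
pose g (z : measurableTypeR R * measurableTypeR R) :=
  (`|z.1 - x0| - b * expR (- z.2))%R.
have mN : measurable_fun setT
    (fun z : measurableTypeR R * measurableTypeR R => (- z.2)%R).
  by apply: measurable_funN; exact: measurable_snd.
have m1 : measurable_fun setT
    (fun z : measurableTypeR R * measurableTypeR R => (z.1 - x0)%R).
  by apply: measurable_funB => //; exact: measurable_fst.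
have mg : measurable_fun setT g.
  apply: measurable_funB.
    exact: (measurableT_comp (@normr_measurable R setT) m1).
  apply: measurable_funM => //.
  exact: (measurableT_comp (@measurable_expR R) mN).
have -> : E b x0 = (snd @^-1` `[0%R, +oo[) `&` (g @^-1` `]-oo, 0%R]).
  by apply/seteqP; split => z; rewrite /E/= !in_itv/= andbT subr_le0.
apply: measurableI.
  by apply: (measurable_preimageT measurable_snd); exact: measurable_itv.
by apply: (measurable_preimageT mg); exact: measurable_itv.
Qed.

Lemma measurable_log_bump b x0 :
  measurable_fun setT (fun x : R => log_bump b (x - x0)).
Proof.
have -> : (fun x : R => log_bump b (x - x0)) = leb \o xsection (E b x0).
  apply/funext => x /=; congr (leb _); apply/seteqP; split => y /=;
    by rewrite /xsection/= inE.
exact: (measurable_fun_xsection _ (mE b x0)).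
Qed.

(** Since [log_bump] is the length of a section of [E b x0], its integral is the area of that
    region. In the other order of integration the section at height [y >= 0] is an interval of
    length [2 b exp(- y)], that is [2 b] times the density of an exponential law. *)
Lemma integral_log_bump b x0 : (0 < b)%R ->
  \int[leb]_x log_bump b (x - x0) = (2 * b)%:E.
Proof.
move=> b0.
pose f : measurableTypeR R * measurableTypeR R -> \bar R := EFin \o \1_(E b x0).
have mf : measurable_fun setT f by apply/measurable_EFinP; exact: measurable_indic.
have f0 z : 0 <= f z by rewrite lee_fin.
transitivity (\int[leb]_x \int[leb]_y f (x, y)).
  apply: eq_integral => x _.
  rewrite -[RHS]/(\int[leb]_y (\1_(E b x0) (x, y))%:E).
  rewrite (_ : (fun y => (\1_(E b x0) (x, y))%:E) =
    (fun y => (\1_([set y | (0 <= y)%R /\ (`|x - x0| <= b * expR (- y))%R]) y)%:E)) //.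
  rewrite integral_indic// ?setIT//.
  have := measurable_xsection x (mE b x0).
  by congr measurable; apply/seteqP; split => y; rewrite /xsection/= inE.
rewrite fubini_tonelli//=.
transitivity (\int[leb]_y ((2 * b) * exponential_pdf 1 y)%:E).
  apply: eq_integral => y _.
  rewrite (_ : (fun x => f (x, y)) = (fun x => (\1_(ysection (E b x0) y) x)%:E)); last first.
    apply/funext => x; rewrite /f/= !indicE; congr ((_ : bool)%:R)%:E.
    by rewrite mem_ysection.
  rewrite integral_indic// ?setIT; last exact: measurable_ysection.
  (* At negative heights both the section and the exponential density vanish. *)
  have [y0|y0] := leP 0%R y; last first.
    rewrite (_ : ysection _ _ = set0) ?measure0.
      by rewrite /exponential_pdf patchE ifF ?mulr0// memNset//= in_itv/= andbT leNgt y0.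
    by apply/seteqP; split => x //; rewrite /ysection/= inE /E/= leNgt y0 => -[].
  transitivity (leb `[(x0 - b * expR (- y))%R, (x0 + b * expR (- y))%R]%classic).
    congr (leb _); apply/seteqP; split => x; rewrite /ysection/= inE /E/= in_itv/= ler_distl.
      by case.
    by split.
  rewrite lebesgue_measure_itv/= lte_fin ltrD2l gtrN ?mulr_gt0 ?expR_gt0//.
  by rewrite -EFinD exponential_pdfE// mul1r mulN1r; congr (_%:E); ring.
under eq_integral do rewrite EFinM.
rewrite ge0_integralZl_EFin//; last 3 first.
- by move=> y _; rewrite lee_fin exponential_pdf_ge0.
- by apply/measurable_EFinP; exact: measurable_exponential_pdf.
- by rewrite mulr_ge0 ?ltW.
by rewrite integral_exponential_pdf// mule1.
Qed.

End log_bump.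

(** * Affine changes of variables *)

Section affine_change_of_variables.
Variable R : realType.
Local Open Scope ereal_scope.

(** The pushforward of [mu] along [phi] is [mu] scaled by [k], and the integral is taken against
    it. *)
Lemma ge0_integral_scaled_map d (T : measurableType d)
    (mu : {measure set T -> \bar R}) (phi : T -> T) (k : R) (f : T -> \bar R) :
  (0 <= k)%R -> measurable_fun setT phi ->
  (forall A, measurable A -> mu (phi @^-1` A) = k%:E * mu A) ->
  measurable_fun setT f -> (forall x, 0 <= f x) ->
  \int[mu]_x f (phi x) = k%:E * \int[mu]_x f x.
Proof.
move=> k0 mphi muphi mf f0.
have := ge0_integral_pushforward mphi mu measurableT mf (fun y _ => f0 y).
rewrite preimage_setT => <-.
transitivity (\int[mscale (NngNum k0) mu]_y f y); last by rewrite ge0_integral_mscale.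
by apply: eq_measure_integral => A mA _; rewrite /= /pushforward muphi.
Qed.

Lemma measurable_affine (c v : R) :
  measurable_fun setT
    ((fun x : R => c * x + v)%R : measurableTypeR R -> measurableTypeR R).
Proof. by apply: measurable_funD => //; exact: measurable_funM. Qed.

(** Multiplied by [c], the pushforward gives every half-open interval its length, so it is the
    Lebesgue measure by uniqueness. *)
Lemma lebesgue_measure_affine (c v : R) (A : set (measurableTypeR R)) :
  (0 < c)%R -> measurable A ->
  lebesgue_measure ((fun x : R => (c * x + v)%R) @^-1` A) =
  c^-1%:E * lebesgue_measure A.
Proof.
move=> c0 mA; have cge0 := ltW c0.
pose P := measure_function_pushforward__canonical__measure_function_Measure
  (@lebesgue_measure R) (measurable_affine c v).
have -> : lebesgue_measure A =
    c%:E * lebesgue_measure ((fun x : R => (c * x + v)%R) @^-1` A).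
  apply: (@lebesgue_measure_unique R (mscale (NngNum cge0) P) _ A mA).
  move=> _ [[a b] _ <-].
  transitivity (c%:E * lebesgue_measure ((fun x : R => (c * x + v)%R) @^-1` `]a, b]));
    last by [].
  have -> : (fun x : R => (c * x + v)%R) @^-1` `]a, b] =
      `]((a - v) / c)%R, ((b - v) / c)%R]%classic.
    apply/seteqP; split => x /=; rewrite !in_itv/= ltr_pdivrMr// ler_pdivlMr//;
      by rewrite ltrBlDr lerBrDr (mulrC x).
  rewrite !lebesgue_measure_itv/= !lte_fin ltr_pM2r ?invr_gt0// ltrD2r.
  case: ifPn => _; last by rewrite mule0.
  by rewrite -!EFinD -EFinM; congr (_%:E); field; rewrite gt_eqF.
by rewrite muleA -EFinM mulVf ?gt_eqF// mul1e.
Qed.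

Lemma measurable_mx_affine m n (c : R) (v : 'M[R]_(m, n)) :
  measurable_fun setT (fun x : 'M[R]_(m, n) => c *: x + v)%R.
Proof.
apply: measurable_fun_mx => i j.
rewrite (_ : (fun _ => _) = fun x : 'M[R]_(m, n) => (c * x i j + v i j)%R).
  by apply: measurable_funD => //; apply: measurable_funM => //;
    exact: measurable_mx_entry.
by apply/funext => x; rewrite !mxE.
Qed.

(** Induction on the dimension: the sections of the preimage along the first coordinate are affine
    preimages of sections of [E], and the substitution in that coordinate gives one more factor
    [c^-1]. *)
Lemma lebesgue_rV_affine k (c : R) (v : 'rV[R]_k) (E : set 'rV[R]_k) :
  (0 < c)%R -> measurable E ->
  lebesgue_rV R k ((fun x : 'rV[R]_k => c *: x + v)%R @^-1` E) =
  (c^-1 ^+ k)%:E * lebesgue_rV R k E.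
Proof.
move=> c0; elim: k v E => [|k IH] v E mE.
  (* In dimension 0 the space is one point and the map is the identity. *)
  rewrite expr0 mul1e /=; congr (\d__ _); apply/seteqP; split => x /=;
    by rewrite (_ : (_ + _)%R = x)//; apply/rowP; case.
pose mu := lebesgue_rV R k.
pose S := (@cons_rV R k) @^-1` E.
have mS : measurable S by exact: (measurable_preimageT (@measurable_cons_rV R k)).
pose v' : 'rV[R]_k := @rsubmx _ 1 1 k v.
have consE x y : cons_rV (c * x + v 0 0, c *: y + v')%R =
    (c *: cons_rV (x, y) + v)%R.
  apply/rowP => i; rewrite /cons_rV !mxE.
  case: split_ordP => l ->; rewrite ?ord1 !mxE//=.
  by rewrite !mulr1n; congr (_ + v _ _)%R; exact/val_inj.
have sec x : xsection (@cons_rV R k @^-1`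
      ((fun x : 'rV[R]_k.+1 => c *: x + v)%R @^-1` E)) x =
    (fun y : 'rV[R]_k => c *: y + v')%R @^-1` (xsection S (c * x + v 0 0)%R).
  by apply/seteqP; split => y; rewrite /xsection/= !inE /S/= consE.
transitivity (\int[lebesgue_measure]_x
    ((c^-1 ^+ k)%:E * (mu \o xsection S) (c * x + v 0 0)%R)).
  apply: eq_integral => x _ /=; rewrite sec IH//.
  exact: measurable_xsection.
have mF : measurable_fun setT (mu \o xsection S) by exact: measurable_fun_xsection.
rewrite ge0_integralZl_EFin//; last 2 first.
  by apply: (measurableT_comp mF (measurable_affine c _)).
  by rewrite exprn_ge0// invr_ge0 ltW.
rewrite (@ge0_integral_scaled_map _ _ lebesgue_measure
  (fun x : R => (c * x + v 0 0)%R) c^-1 (mu \o xsection S))//.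
- by rewrite muleA -EFinM -exprSr.
- by rewrite invr_ge0 ltW.
- exact: measurable_affine.
- by move=> A mA; exact: lebesgue_measure_affine.
Qed.

End affine_change_of_variables.

Section lebesgue_mx_theory.
Variable R : realType.
Local Open Scope ereal_scope.

Lemma measurable_mxvec m n :
  measurable_fun setT (@mxvec R m n : 'M[R]_(m, n) -> 'rV[R]_(m * n)).
Proof.
apply: measurable_fun_mx => i j; rewrite ord1.
case/mxvec_indexP: j => k l.
rewrite (_ : (fun _ => _) = fun x : 'M[R]_(m, n) => x k l).
  exact: measurable_mx_entry.
by apply/funext => x; rewrite mxvecE.
Qed.

Lemma lebesgue_mx_sigma_finite m n : sigma_finite setT (@lebesgue_mx R m n).
Proof.
have /sigma_finiteP[F [TF _ Foo]] := sigma_finiteT (lebesgue_rV R (m * n)).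
exists (fun i => mxvec @^-1` F i).
  by rewrite -preimage_bigcup -TF preimage_setT.
move=> i; have [mF Fi] := Foo i; split.
  exact: (measurable_preimageT (@measurable_mxvec m n)).
rewrite /lebesgue_mx /pushforward -comp_preimage (_ : _ \o _ = id)//.
by apply/funext => x /=; rewrite vec_mxK.
Qed.

HB.instance Definition _ m n := Measure_isSigmaFinite.Build _ _ _
  (@lebesgue_mx R m n) (@lebesgue_mx_sigma_finite m n).

Lemma lebesgue_mx_affine m n (c : R) (v : 'M[R]_(m, n)) (E : set 'M[R]_(m, n)) :
  (0 < c)%R -> measurable E ->
  lebesgue_mx ((fun x : 'M[R]_(m, n) => c *: x + v)%R @^-1` E) =
  (c^-1 ^+ (m * n))%:E * lebesgue_mx E.
Proof.
move=> c0 mE; rewrite /lebesgue_mx /pushforward.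
rewrite -(lebesgue_rV_affine (mxvec v)) //; last first.
  exact: (measurable_preimageT (@measurable_vec_mx R m n)).
congr (lebesgue_rV R _ _); apply/seteqP; split => x /=;
  by rewrite linearD linearZ/= mxvecK.
Qed.

Lemma ge0_integral_mx_affine m n (c : R) (v : 'M[R]_(m, n))
    (f : 'M[R]_(m, n) -> \bar R) :
  (0 < c)%R -> measurable_fun setT f -> (forall x, 0 <= f x) ->
  \int[@lebesgue_mx R m n]_x f (c *: x + v)%R =
  (c^-1 ^+ (m * n))%:E * \int[@lebesgue_mx R m n]_x f x.
Proof.
move=> c0 mf f0.
apply: (@ge0_integral_scaled_map R _ _ (@lebesgue_mx R m n)
  (fun x : 'M[R]_(m, n) => (c *: x + v)%R) _ f) => //.
- by rewrite exprn_ge0// invr_ge0 ltW.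
- exact: measurable_mx_affine.
- by move=> A mA; exact: lebesgue_mx_affine.
Qed.

Lemma measurable_rV_cube k (r : R) :
  measurable [set v : 'rV[R]_k | forall i, (`|v 0 i| <= r)%R].
Proof.
rewrite (_ : [set v | _] =
    \bigcap_(i in [set: 'I_k]) ((fun v : 'rV[R]_k => v 0%R i) @^-1` `[(- r)%R, r])).
  apply: fin_bigcap_measurable => [|i _]; first exact: finite_finset.
  by apply: (measurable_preimageT (measurable_mx_entry _ _)); exact: measurable_itv.
apply/seteqP; split => v /=; first by move=> vr i _ /=; rewrite in_itv/= -ler_norml.
by move=> vr i; have := vr i I; rewrite /= in_itv/= -ler_norml.
Qed.

Lemma lebesgue_rV_cube k (r : R) : (0 < r)%R ->
  lebesgue_rV R k [set v : 'rV[R]_k | forall i, (`|v 0 i| <= r)%R] =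
  ((2 * r) ^+ k)%:E.
Proof.
move=> r0; elim: k => [|k IH].
  by rewrite expr0 /= diracE mem_set//= => -[].
rewrite -[LHS]/((@lebesgue_measure R \x lebesgue_rV R k) (@cons_rV R k @^-1` _)).
have -> : @cons_rV R k @^-1` [set v | forall i, (`|v 0 i| <= r)%R] =
    `[(- r)%R, r]%classic `*` [set v : 'rV[R]_k | forall i, (`|v 0 i| <= r)%R].
  apply/seteqP; split => -[x v] /=.
    move=> xv; split.
      have := xv 0%R; rewrite in_itv/= -ler_norml.
      by have := cons_rVK (x, v); rewrite /uncons_rV => -[-> _].
    move=> i; have := xv (@rshift 1 k i).
    have := cons_rVK (x, v); rewrite /uncons_rV => -[_ /rowP /(_ i)].
    by rewrite mxE => ->.
  rewrite in_itv/= -ler_norml => -[xr vr] i; rewrite /cons_rV mxE.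
  by case: split_ordP => l _ //; rewrite !mxE ord1 eqxx mulr1n.
rewrite product_measure1E//; last exact: measurable_rV_cube.
transitivity ((2 * r)%:E * ((2 * r) ^+ k)%:E); last by rewrite -EFinM -exprS.
congr (_ * _); last exact: IH.
transitivity (@lebesgue_measure R `[(- r)%R, r]); first by [].
rewrite lebesgue_measure_itv/= lte_fin gtrN// -EFinD.
by congr (_%:E); ring.
Qed.

Lemma measurable_mx_cube m n (r : R) :
  measurable [set v : 'M[R]_(m, n) | forall i j, (`|v i j| <= r)%R].
Proof.
rewrite (_ : [set v | _] =
    mxvec @^-1` [set v : 'rV[R]_(m * n) | forall i, (`|v 0 i| <= r)%R]).
  by apply: (measurable_preimageT (@measurable_mxvec m n)); exact: measurable_rV_cube.
apply/seteqP; split => v /= vr.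
  by case/mxvec_indexP => i j; rewrite mxvecE.
by move=> i j; have := vr (mxvec_index i j); rewrite mxvecE.
Qed.

Lemma lebesgue_mx_cube m n (r : R) : (0 < r)%R ->
  lebesgue_mx [set v : 'M[R]_(m, n) | forall i j, (`|v i j| <= r)%R] =
  ((2 * r) ^+ (m * n))%:E.
Proof.
move=> r0; rewrite -lebesgue_rV_cube// /lebesgue_mx /pushforward.
congr (lebesgue_rV R _ _); apply/seteqP; split => v /=.
  by move=> vr k; case/mxvec_indexP: k => i j; have := vr i j; rewrite mxE.
by move=> vr i j; rewrite mxE.
Qed.

End lebesgue_mx_theory.

(** * Averaging over segments *)

Section averaging.
Local Open Scope ereal_scope.

(** Both sides are iterated integrals of [f] extended by 0 outside the rectangle. *)
Lemma fubini_tonelli_setX d1 d2 (T1 : measurableType d1) (T2 : measurableType d2)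
    (R : realType) (m1 : {sigma_finite_measure set T1 -> \bar R})
    (m2 : {sigma_finite_measure set T2 -> \bar R}) (D1 : set T1) (D2 : set T2)
    (f : T1 * T2 -> \bar R) :
  measurable D1 -> measurable D2 -> measurable_fun setT f ->
  (forall z, 0 <= f z) ->
  \int[m1]_(x in D1) \int[m2]_(y in D2) f (x, y) =
  \int[m2]_(y in D2) \int[m1]_(x in D1) f (x, y).
Proof.
move=> mD1 mD2 mf f0.
have mD : measurable (D1 `*` D2) by exact: measurableX.
pose g := f \_ (D1 `*` D2).
have mg : measurable_fun setT g.
  by apply/(measurable_restrictT _ mD); exact: measurable_funS mf.
have g0 z : 0 <= g z by apply: erestrict_ge0.
have gE x y : g (x, y) = if (x \in D1) && (y \in D2) then f (x, y) else 0.
  by rewrite /g patchE in_setX.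
transitivity (\int[m1]_x \int[m2]_y g (x, y)).
  rewrite integral_mkcond; apply: eq_integral => x _; rewrite patchE.
  case: ifPn => xD.
    rewrite integral_mkcond; apply: eq_integral => y _.
    by rewrite patchE gE xD.
  by rewrite integral0_eq// => y _; rewrite gE (negbTE xD).
rewrite fubini_tonelli//; apply/esym.
rewrite integral_mkcond; apply: eq_integral => y _; rewrite patchE.
case: ifPn => yD.
  rewrite integral_mkcond; apply: eq_integral => x _.
  by rewrite patchE gE yD andbT.
by rewrite integral0_eq// => x _; rewrite gE (negbTE yD) andbF.
Qed.

Lemma measurable_fun_integral_in d1 d2 (T1 : measurableType d1)
    (T2 : measurableType d2) (R : realType)
    (m2 : {sigma_finite_measure set T2 -> \bar R}) (D2 : set T2)
    (f : T1 * T2 -> \bar R) :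
  measurable D2 -> measurable_fun setT f -> (forall z, 0 <= f z) ->
  measurable_fun setT (fun x => \int[m2]_(y in D2) f (x, y)).
Proof.
move=> mD2 mf f0; pose g := f \_ (setT `*` D2).
have mD : measurable ([set: T1] `*` D2) by exact: measurableX.
have mg : measurable_fun setT g.
  by apply/(measurable_restrictT _ mD); exact: measurable_funS mf.
have g0 z : 0 <= g z by apply: erestrict_ge0.
rewrite (_ : (fun _ => _) = fun x => \int[m2]_y g (x, y)).
  exact: measurable_fun_fubini_tonelli_F.
apply/funext => x; rewrite integral_mkcond; apply: eq_integral => y _.
by rewrite /g !patchE in_setX in_setT.
Qed.

Lemma measurable_fun_integral_in_swap d1 d2 (T1 : measurableType d1)
    (T2 : measurableType d2) (R : realType)
    (m1 : {sigma_finite_measure set T1 -> \bar R}) (D1 : set T1)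
    (f : T1 * T2 -> \bar R) :
  measurable D1 -> measurable_fun setT f -> (forall z, 0 <= f z) ->
  measurable_fun setT (fun y => \int[m1]_(x in D1) f (x, y)).
Proof.
move=> mD1 mf f0.
apply: (@measurable_fun_integral_in _ _ _ _ _ m1 D1 (f \o (fun z => (z.2, z.1)))) => //.
  apply: (measurableT_comp mf).
  exact: (measurable_fun_pair measurable_snd measurable_fst).
by move=> z; exact: f0.
Qed.

Variables (R : realType) (m n : nat).
Notation mu := (@lebesgue_mx R m n).
Notation leb := (@lebesgue_measure R).
Implicit Types (C : set 'M[R]_(m, n)) (h : 'M[R]_(m, n) -> \bar R).

(** As [C] is mapped into itself, the left integrand is at most [h \_ C] composed with the affine
    map. The change of variables over the whole space then gives the factor. *)
Lemma ge0_integral_contract C (k : R) (v : 'M[R]_(m, n)) h :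
  (0 < k)%R -> measurable C -> (forall x, C x -> C (k *: x + v)%R) ->
  measurable_fun setT h -> (forall x, 0 <= h x) ->
  \int[mu]_(x in C) h (k *: x + v)%R <=
  (k^-1 ^+ (m * n))%:E * \int[mu]_(x in C) h x.
Proof.
move=> k0 mC CC mh h0.
have mhC : measurable_fun setT (h \_ C).
  by apply/(measurable_restrictT _ mC); exact: measurable_funS mh.
have hC0 x : 0 <= (h \_ C) x by apply: erestrict_ge0.
have maff := @measurable_mx_affine R m n k v.
rewrite [in leRHS]integral_mkcond -(ge0_integral_mx_affine v)//.
rewrite [in leLHS]integral_mkcond; apply: ge0_le_integral => //.
- by move=> x _; apply: erestrict_ge0.
- apply/(measurable_restrictT _ mC); apply: measurable_funTS.
  exact: (measurableT_comp mh maff).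
- exact: (measurableT_comp mhC maff).
- move=> x _; rewrite patchE; case: ifPn => // /set_mem /CC Cx.
  by rewrite patchE mem_set.
Qed.

Lemma measurable_segment : measurable (`[(-1)%R, 1%R] : set (measurableTypeR R)).
Proof. exact: measurable_itv. Qed.

Lemma lebesgue_segment : leb `[(-1)%R, 1%R] = 2%:E.
Proof.
by rewrite lebesgue_measure_itv/= lte_fin gtrN// -EFinD; congr (_%:E); ring.
Qed.

(* For x uniform in C and s uniform in [-1, 1], the density of k x + p + s q is
   at most k^-N times that of x. *)
Lemma averaging C (k B : R) (p q : 'M[R]_(m, n)) h :
  (0 < k)%R -> (0 <= B)%R -> measurable C ->
  (forall x (s : R), C x -> `[(-1)%R, 1%R]%classic s ->
     C (k *: x + (p + s *: q))%R) ->
  measurable_fun setT h -> (forall x, 0 <= h x) ->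
  (forall x, \int[leb]_(s in `[(-1)%R, 1%R]) h (x - s *: (k^-1 *: q))%R
             <= (2 * B)%:E) ->
  \int[mu]_(x in C) h x <= (k^-1 ^+ (m * n) * B)%:E * mu C.
Proof.
move=> k0 B0 mC CC mh h0 hB.
pose I : set (measurableTypeR R) := `[(-1)%R, 1%R]%classic.
have mI : measurable I := measurable_segment.
(* [G (s, -)] inverts [x |-> k x + (p + s q)], so contracting [h (G (s, -))] gives back the integral
   of [h] on the left. *)
pose G (z : measurableTypeR R * 'M[R]_(m, n)) : 'M[R]_(m, n) :=
  (k^-1 *: (z.2 - p) - z.1 *: (k^-1 *: q))%R.
have mG : measurable_fun setT G.
  apply: measurable_fun_mx => i j.
  have m2 : measurable_fun setT
      (fun z : measurableTypeR R * 'M[R]_(m, n) => z.2 i j).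
    exact: (measurableT_comp (measurable_mx_entry i j) measurable_snd).
  have m1 : measurable_fun setT
      (fun z : measurableTypeR R * 'M[R]_(m, n) => z.1 : R).
    exact: measurable_fst.
  have GE : (fun z => G z i j) = (fun z : measurableTypeR R * 'M[R]_(m, n) =>
      (k^-1 * (z.2 i j - p i j) - z.1 * (k^-1 * q i j))%R).
    by apply/funext => z; rewrite !mxE.
  rewrite GE; exact: (measurable_funB
    (measurable_funM (measurable_cst _) (measurable_funB m2 (measurable_cst _)))
    (measurable_funM m1 (measurable_cst _))).
have mhG := measurableT_comp mh mG.
have hs (s : R) : I s -> \int[mu]_(x in C) h x <=
    (k^-1 ^+ (m * n))%:E * \int[mu]_(x in C) h (G (s, x)).
  move=> Is; pose f x := h (G (s, x)).
  have mf : measurable_fun setT f.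
    exact: (measurableT_comp mhG (pair1_measurable s)).
  have := @ge0_integral_contract C k (p + s *: q)%R f k0 mC (fun x Cx => CC x s Cx Is)
    mf (fun x => h0 _).
  apply: le_trans; rewrite le_eqVlt; apply/orP; left; apply/eqP.
  apply: eq_integral => x _; congr (h _); rewrite /G/=.
  by apply/matrixP => i j; rewrite !mxE; field; rewrite gt_eqF.
have c0 : (0 <= k^-1 ^+ (m * n))%R by rewrite exprn_ge0// invr_ge0 ltW.
have mint : measurable_fun setT (fun s => \int[mu]_(x in C) h (G (s, x))).
  exact: (@measurable_fun_integral_in _ _ _ _ R mu C (h \o G) mC mhG (fun=> h0 _)).
(* The bound [hs] is integrated over [s]; its left side does not depend on [s]. *)
have h2 : \int[mu]_(x in C) h x * leb I <=
    (k^-1 ^+ (m * n))%:E * \int[leb]_(s in I) \int[mu]_(x in C) h (G (s, x)).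
  rewrite -integral_cst// -ge0_integralZl_EFin//; last 2 first.
  - by move=> s _; exact: integral_ge0.
  - exact: measurable_funTS.
  apply: ge0_le_integral => //; first by move=> s _; exact: integral_ge0.
  by apply: measurable_funeM; exact: measurable_funTS.
have {h2} : \int[mu]_(x in C) h x * 2%:E <=
    (k^-1 ^+ (m * n))%:E * \int[mu]_(x in C) (2 * B)%:E.
  rewrite -[in leLHS]lebesgue_segment (le_trans h2)// lee_wpmul2l//.
  (* After the exchange, the inner integral runs along the line through [k^-1 (x - p)], where [hB]
     applies. *)
  rewrite (@fubini_tonelli_setX _ _ _ _ R leb mu I C (h \o G) mI mC mhG (fun=> h0 _)).
  apply: ge0_le_integral => //.
  - by move=> x _; apply: integral_ge0 => s _; exact: h0.
  - apply: measurable_funTS.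
    exact: (@measurable_fun_integral_in_swap _ _ _ _ R leb I (h \o G) mI mhG (fun=> h0 _)).
  - move=> x _; apply: le_trans (hB (k^-1 *: (x - p))%R).
    by [].
rewrite integral_cst// muleA -EFinM mulrCA mulrC EFinM muleAC.
by rewrite lee_pmul2r.
Qed.

End averaging.

(** * Frobenius norm, unit ball and cones *)

Section frobenius_theory.
Variables (R : realType) (n : nat).
Implicit Types (A B M Z : 'M[R]_n) (c r : R).

Lemma frob_innerE A B : frob_inner A B = \sum_i \sum_j A i j * B i j.
Proof.
by apply: eq_bigr => i _; rewrite mxE; apply: eq_bigr => j _; rewrite mxE.
Qed.

Lemma frob_innerC A B : frob_inner A B = frob_inner B A.
Proof.
by rewrite !frob_innerE; apply: eq_bigr => i _; apply: eq_bigr => j _; rewrite mulrC.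
Qed.

Lemma frob_innerDr A B M : frob_inner A (B + M) = frob_inner A B + frob_inner A M.
Proof. by rewrite /frob_inner linearD mulmxDr raddfD. Qed.

Lemma frob_innerZr c A B : frob_inner A (c *: B) = c * frob_inner A B.
Proof. by rewrite /frob_inner linearZ -scalemxAr mxtraceZ. Qed.

Lemma frob_innerDl A B M : frob_inner (A + B) M = frob_inner A M + frob_inner B M.
Proof. by rewrite frob_innerC frob_innerDr !(frob_innerC M). Qed.

Lemma frob_innerZl c A B : frob_inner (c *: A) B = c * frob_inner A B.
Proof. by rewrite frob_innerC frob_innerZr frob_innerC. Qed.

Lemma frob_inner_ge0 A : 0 <= frob_inner A A.
Proof.
by rewrite frob_innerE sumr_ge0// => i _; rewrite sumr_ge0// => j _; exact: sqr_ge0.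
Qed.

Lemma frob_norm_ge0 A : 0 <= frob_norm A.
Proof. exact: sqrtr_ge0. Qed.

Lemma sqr_frob_norm A : frob_norm A ^+ 2 = frob_inner A A.
Proof. by rewrite sqr_sqrtr// frob_inner_ge0. Qed.

Lemma frob_normZ c A : frob_norm (c *: A) = `|c| * frob_norm A.
Proof.
rewrite /frob_norm frob_innerZl frob_innerZr mulrA -expr2 sqrtrM ?sqr_ge0//.
by rewrite sqrtr_sqr.
Qed.

Lemma frob_normN A : frob_norm (- A) = frob_norm A.
Proof. by rewrite -scaleN1r frob_normZ normrN1 mul1r. Qed.

Lemma ler_entry_frob_norm A i j : `|A i j| <= frob_norm A.
Proof.
rewrite -sqrtr_sqr ler_sqrt ?frob_inner_ge0// frob_innerE.
rewrite (bigD1 i)//= (bigD1 j)//= expr2 -addrA lerDl addr_ge0//.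
  by rewrite sumr_ge0// => k _; exact: sqr_ge0.
by rewrite sumr_ge0// => k _; rewrite sumr_ge0// => l _; exact: sqr_ge0.
Qed.

Lemma frob_norm_eq0 A : frob_norm A = 0 -> A = 0.
Proof.
move=> A0; apply/matrixP => i j; rewrite mxE; apply/eqP.
by rewrite -normr_le0 -A0 ler_entry_frob_norm.
Qed.

Lemma frob_norm0 : frob_norm (0 : 'M[R]_n) = 0.
Proof. by rewrite -(scale0r (0 : 'M[R]_n)) frob_normZ normr0 mul0r. Qed.

Lemma frob_norm_le_entries A r : 0 <= r -> (forall i j, `|A i j| <= r) ->
  frob_norm A <= n%:R * r.
Proof.
move=> r0 Ar; rewrite -[leRHS]ger0_norm ?mulr_ge0// -sqrtr_sqr ler_wsqrtr//.
rewrite frob_innerE (@le_trans _ _ (\sum_(i < n) \sum_(j < n) r ^+ 2))//.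
  apply: ler_sum => i _; apply: ler_sum => j _.
  by rewrite -expr2 -real_normK ?num_real// ler_sqr ?nnegrE.
rewrite !sumr_const !card_ord -mulrnA -[leLHS]mulr_natl natrM exprMn expr2.
exact: lexx.
Qed.

Lemma frob_cauchy_schwarz A B : `|frob_inner A B| <= frob_norm A * frob_norm B.
Proof.
have [B0|B0] := eqVneq (frob_norm B) 0.
  rewrite (frob_norm_eq0 B0) frob_norm0 mulr0.
  by rewrite -(scale0r (0 : 'M[R]_n)) frob_innerZr mul0r normr0.
rewrite -[leRHS]ger0_norm ?mulr_ge0 ?frob_norm_ge0// -!sqrtr_sqr ler_wsqrtr//.
rewrite exprMn.
have B2 : 0 < frob_norm B ^+ 2 by rewrite exprn_even_gt0.
(* This squared norm expands to [|B|^2 (|A|^2 |B|^2 - <A, B>^2)]. *)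
have := frob_inner_ge0 (frob_norm B ^+ 2 *: A + (- frob_inner A B) *: B).
rewrite !(frob_innerDl, frob_innerDr, frob_innerZl, frob_innerZr).
rewrite (frob_innerC B A) -!sqr_frob_norm.
set a := frob_norm A ^+ 2; set b := frob_norm B ^+ 2; set x := frob_inner A B.
rewrite (_ : _ + _ = b * (a * b - x ^+ 2)); last by ring.
by rewrite pmulr_rge0// subr_ge0.
Qed.

Lemma ler_frob_normD A B : frob_norm (A + B) <= frob_norm A + frob_norm B.
Proof.
rewrite -ler_sqr ?nnegrE ?addr_ge0 ?frob_norm_ge0// sqrrD !sqr_frob_norm.
rewrite frob_innerDl !frob_innerDr (frob_innerC B A).
have := le_trans (ler_norm _) (frob_cauchy_schwarz A B).
by lra.
Qed.

Definition frob_ball : set 'M[R]_n := [set M | frob_norm M <= 1].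

(** For [A] of norm 1 and [gamma] the cosine of an angle, this is the solid cone over the open
    spherical cap of that angular radius. The strict inequality excludes the apex. *)
Definition frob_cone A (gamma : R) : set 'M[R]_n :=
  [set M | frob_norm M <= 1 /\ gamma * frob_norm M < frob_inner A M].

(** Convexity of the ball. The summand [0] is the translation [p] of [averaging]. *)
Lemma frob_ball_contract M a s k : frob_ball M -> frob_ball a -> -1 <= s <= 1 ->
  0 <= k <= 1 -> frob_ball (k *: M + (0 + s *: ((1 - k) *: a))).
Proof.
rewrite /frob_ball/= -ler_norml add0r => M1 a1 s1 /andP[k0 k1].
rewrite (le_trans (ler_frob_normD _ _))// !frob_normZ (ger0_norm k0).
rewrite [`|1 - k|]ger0_norm ?subr_ge0//.
have k1' : 0 <= 1 - k by rewrite subr_ge0.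
have : k * frob_norm M <= k * 1 by exact: ler_wpM2l.
have : `|s| * ((1 - k) * frob_norm a) <= 1 * ((1 - k) * 1).
  rewrite ler_pM// ?mulr_ge0 ?frob_norm_ge0//.
  exact: ler_wpM2l.
by lra.
Qed.

(* The ball of center A / (1 + sigma) and radius sigma / (1 + sigma) is
   contained in the closure of the cone. *)
Lemma frob_cone_contract A M a sigma s k :
  frob_norm A = 1 -> 0 < sigma <= 1 ->
  frob_cone A (Num.sqrt (1 - sigma ^+ 2)) M -> frob_ball a -> -1 <= s <= 1 ->
  0 < k <= 1 ->
  frob_cone A (Num.sqrt (1 - sigma ^+ 2))
    (k *: M + (((1 - k) / (1 + sigma)) *: A +
               s *: (((1 - k) * sigma / (1 + sigma)) *: a))).
Proof.
move=> A1 /andP[sigma0 sigma1] [M1 AM] a1 s1 /andP[k0 k1].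
set gamma := Num.sqrt _ in AM *.
have gamma0 : 0 <= gamma by exact: sqrtr_ge0.
have gamma2 : gamma ^+ 2 = 1 - sigma ^+ 2 by rewrite sqr_sqrtr// subr_ge0 expr_le1// ltW.
(* The image point will be the convex combination [k M + (1 - k) y]; it remains to place [y] in the
   unit ball and in the closed cone. *)
pose y := (1 + sigma)^-1 *: (A + (s * sigma) *: a).
have sg0 : 0 < 1 + sigma by rewrite addr_gt0.
have sa1 : `|s| * frob_norm a <= 1.
  by rewrite -[leRHS]mulr1 ler_pM ?frob_norm_ge0// ler_norml.
have y1 : frob_norm y <= 1.
  rewrite frob_normZ gtr0_norm ?invr_gt0// mulrC ler_pdivrMr// mul1r.
  rewrite (le_trans (ler_frob_normD _ _))// A1 lerD2l frob_normZ normrM.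
  rewrite mulrAC (gtr0_norm sigma0) -[leRHS]mul1r.
  by rewrite ler_wpM2r// ltW.
have Ay : gamma * frob_norm y <= frob_inner A y.
  rewrite frob_normZ gtr0_norm ?invr_gt0// frob_innerZr mulrCA.
  rewrite ler_wpM2l ?invr_ge0 ?(ltW sg0)//.
  pose al := frob_inner A a.
  have al1 : `|s * al| <= 1.
    rewrite normrM (le_trans _ sa1)// ler_wpM2l//.
    by rewrite (le_trans (frob_cauchy_schwarz _ _))// A1 mul1r.
  have ip : frob_inner A (A + (s * sigma) *: a) = 1 + sigma * (s * al).
    by rewrite frob_innerDr frob_innerZr -sqr_frob_norm A1 /al; ring.
  have ip0 : 0 <= 1 + sigma * (s * al).
    move: al1; rewrite ler_norml => /andP[h1 h2].
    have : sigma * (-1) <= sigma * (s * al) by rewrite ler_wpM2l// ltW.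
    by lra.
  rewrite ip -ler_sqr ?nnegrE ?mulr_ge0 ?frob_norm_ge0// exprMn gamma2.
  rewrite sqr_frob_norm frob_innerDl !frob_innerDr !frob_innerZl !frob_innerZr.
  rewrite (frob_innerC a A) -/al -!sqr_frob_norm A1.
  have sa2 : s ^+ 2 * frob_norm a ^+ 2 <= 1.
    by rewrite -exprMn -real_normK ?num_real// normrM (ger0_norm (frob_norm_ge0 a)) expr_le1// ?mulr_ge0 ?frob_norm_ge0.
  set w := s ^+ 2 * _ in sa2.
  have -> : 1 ^+ 2 + s * sigma * al +
      (s * sigma * al + s * sigma * (s * sigma * frob_norm a ^+ 2)) =
      1 + 2 * sigma * (s * al) + sigma ^+ 2 * w by rewrite /w; ring.
  set z := s * al in al1 ip0 *.
  have sq : 0 <= sigma ^+ 2 * (z + sigma) ^+ 2 by rewrite mulr_ge0// sqr_ge0.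
  have hw : (1 - sigma ^+ 2) * (sigma ^+ 2 * w) <= (1 - sigma ^+ 2) * (sigma ^+ 2 * 1).
    by rewrite !ler_wpM2l ?sqr_ge0// -gamma2 sqr_ge0.
  (* With [z = s <A, a>] and [w = |s a|^2 <= 1], the difference of the two squares is [sigma^2 (z +
     sigma)^2 + (1 - sigma^2) sigma^2 (1 - w)]. *)
  rewrite -subr_ge0.
  rewrite (_ : _ - _ = sigma ^+ 2 * (z + sigma) ^+ 2 + ((1 - sigma ^+ 2) *
    (sigma ^+ 2 * 1) - (1 - sigma ^+ 2) * (sigma ^+ 2 * w))); last by ring.
  by rewrite addr_ge0// subr_ge0.
have -> : k *: M + ((1 - k) / (1 + sigma) *: A +
    s *: ((1 - k) * sigma / (1 + sigma) *: a)) = k *: M + (1 - k) *: y.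
  by apply/matrixP => i j; rewrite /y !mxE; field; rewrite gt_eqF.
have k1' : 0 <= 1 - k by rewrite subr_ge0.
have nle : frob_norm (k *: M + (1 - k) *: y) <= k * frob_norm M + (1 - k) * frob_norm y.
  by rewrite (le_trans (ler_frob_normD _ _))// !frob_normZ (gtr0_norm k0) ger0_norm.
split.
  have : k * frob_norm M <= k * 1 by rewrite ler_wpM2l// ltW.
  have : (1 - k) * frob_norm y <= (1 - k) * 1 by rewrite ler_wpM2l.
  by move: nle; lra.
rewrite frob_innerDr (frob_innerZr k) (frob_innerZr (1 - k)).
apply: (@le_lt_trans _ _ (gamma * (k * frob_norm M + (1 - k) * frob_norm y))).
  exact: ler_wpM2l.
(* Strictness comes from [M], whose weight [k] is positive; [y] only satisfies the large
   inequality. *)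
rewrite mulrDr !(mulrCA gamma) ltr_leD//; first by rewrite ltr_pM2l.
exact: ler_wpM2l.
Qed.

(** The cosine decreases on [[0, pi]], where both angles lie, and [cos (asin sigma)] is
    [sqrt (1 - sigma^2)]. *)
Lemma frob_cone_sphere_ball A sigma : frob_norm A = 1 -> 0 < sigma <= 1 ->
  [set M | punctured_ball M /\ sphere_ball A sigma (sphere_proj M)] =
  frob_cone A (Num.sqrt (1 - sigma ^+ 2)).
Proof.
move=> A1 /andP[sigma0 sigma1].
have s11 : -1 <= sigma <= 1 by rewrite sigma1 andbT (le_trans _ (ltW sigma0)).
have gammaE : cos (asin sigma) = Num.sqrt (1 - sigma ^+ 2) by exact: cos_asin.
set gamma := Num.sqrt _ in gammaE *.
have asinI : asin sigma \in `[0, pi].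
  have pi2 : 0 < pi / 2 :> R by rewrite divr_gt0// pi_gt0.
  have asin_le := asin_lepi2 s11.
  rewrite in_itv/=; apply/andP; split; last first.
    by rewrite (le_trans asin_le)// ler_pdivrMr// ler_peMr ?pi_ge0// ler1n.
  have I0 : (0 : R) \in `[- (pi / 2), pi / 2].
    by rewrite in_itv/= oppr_le0 ltW.
  have Is : asin sigma \in `[- (pi / 2), pi / 2].
    by rewrite in_itv/= asin_geNpi2.
  rewrite leNgt -(ltr_sin Is I0) sin0 asinK ?in_itv//= -leNgt; exact: ltW.
have coneE M : 0 < frob_norm M ->
    (acos (frob_inner A (sphere_proj M)) < asin sigma) =
    (gamma * frob_norm M < frob_inner A M).
  move=> M0; have ipE : frob_inner A (sphere_proj M) = frob_inner A M / frob_norm M.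
    by rewrite frob_innerZr mulrC.
  have xI : frob_inner A (sphere_proj M) \in `[-1, 1].
    rewrite in_itv/= -ler_norml ipE normrM normfV (gtr0_norm M0) ler_pdivrMr//.
    by rewrite mul1r (le_trans (frob_cauchy_schwarz _ _))// A1 mul1r.
  have aI : acos (frob_inner A (sphere_proj M)) \in `[0, pi].
    by move: (xI); rewrite !in_itv/= => xI'; rewrite acos_ge0// acos_lepi.
  by rewrite -(ltr_cos aI asinI) gammaE acosK// ipE ltr_pdivlMr.
apply/seteqP; split => M.
  by move=> [/andP[M0 M1] [_]]; rewrite /angle coneE.
move=> [M1 AM]; have M0 : 0 < frob_norm M.
  rewrite lt_neqAle frob_norm_ge0 andbT eq_sym; apply/eqP => M0.
  move: AM; rewrite (frob_norm_eq0 M0) frob_norm0 mulr0.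
  by rewrite -(scale0r (0 : 'M[R]_n)) frob_innerZr mul0r ltxx.
split; first by rewrite /punctured_ball/= M0.
split; last by rewrite /angle coneE.
by rewrite /frob_sphere/= frob_normZ gtr0_norm ?invr_gt0// mulVf// gt_eqF.
Qed.

Lemma measurable_frob_ball : measurable frob_ball.
Proof.
rewrite [X in measurable X](_ : _ = @frob_norm R n @^-1` `]-oo, 1]).
  by apply: (measurable_preimageT (@measurable_frob_norm R n)); exact: measurable_itv.
by apply/seteqP; split => M; rewrite /frob_ball/= in_itv.
Qed.

Lemma measurable_frob_cone A gamma : measurable (frob_cone A gamma).
Proof.
rewrite (_ : frob_cone A gamma = frob_ball `&`
    ((fun M => frob_inner A M - gamma * frob_norm M) @^-1` `]0, +oo[)).
  apply: measurableI; first exact: measurable_frob_ball.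
  have mf : measurable_fun setT (fun M => frob_inner A M - gamma * frob_norm M).
    apply: measurable_funB.
      by apply: measurable_frob_inner; [exact: measurable_cst|exact: measurable_id].
    apply: measurable_funM; first exact: measurable_cst.
    exact: measurable_frob_norm.
  by apply: (measurable_preimageT mf); exact: measurable_itv.
by apply/seteqP; split => M; rewrite /frob_cone/frob_ball/= in_itv/= andbT subr_gt0.
Qed.

End frobenius_theory.

(** * Volume of the unit ball and of the cone *)

Section ball_volume.
Variables (R : realType) (n : nat).
Local Open Scope ereal_scope.
Notation mu := (@lebesgue_mx R n n).

Lemma lebesgue_frob_ball_lty : mu (@frob_ball R n) < +oo.
Proof.
apply: (@le_lt_trans _ _ (mu [set v | forall i j, (`|v i j| <= 1)%R])); last first.
  by rewrite lebesgue_mx_cube// ltry.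
apply: le_measure; rewrite ?inE.
- exact: measurable_frob_ball.
- exact: measurable_mx_cube.
- by move=> M M1 i j; exact: (le_trans (ler_entry_frob_norm _ _ _)).
Qed.

Lemma lebesgue_frob_ball_gt0 : (0 < n)%N -> 0 < mu (@frob_ball R n).
Proof.
move=> n0; have n0' : (0 < n%:R^-1 :> R)%R by rewrite invr_gt0 ltr0n.
apply: (@lt_le_trans _ _ (mu [set v | forall i j, (`|v i j| <= n%:R^-1)%R])).
  by rewrite lebesgue_mx_cube// lte_fin exprn_gt0// mulr_gt0.
apply: le_measure; rewrite ?inE.
- exact: measurable_mx_cube.
- exact: measurable_frob_ball.
- move=> M /(frob_norm_le_entries (ltW n0')) /le_trans; apply.
  by rewrite mulfV// pnatr_eq0 -lt0n.
Qed.

(** The cone contains a scaled and translated copy of the unit ball, provided by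
    [frob_cone_contract] at the point [A / 2] of the cone with [k = 1 / 2] and [s = 1]. *)
Lemma lebesgue_frob_cone_gt0 (A : 'M[R]_n) sigma : (0 < n)%N ->
  frob_norm A = 1%R -> (0 < sigma <= 1)%R ->
  0 < mu (frob_cone A (Num.sqrt (1 - sigma ^+ 2))).
Proof.
move=> n0 A1 s01; have /andP[s0 s1] := s01.
set gamma := Num.sqrt _.
have gamma1 : (gamma < 1)%R.
  by rewrite -[ltRHS]sqrtr1 ltr_sqrt// ltrBlDr ltrDl exprn_gt0.
have h01 : (0 < (2^-1 : R) <= 1)%R by lra.
have cone0 : frob_cone A gamma (2^-1 *: A)%R.
  rewrite /frob_cone/= frob_normZ A1 frob_innerZr -sqr_frob_norm A1 expr1n !mulr1.
  by rewrite ger0_norm// gtr_pMl//; split=> //; lra.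
pose c := ((1 - 2^-1) * sigma / (1 + sigma))%R : R.
have c0 : (0 < c)%R by rewrite divr_gt0// ?addr_gt0// mulr_gt0//; lra.
pose v : 'M[R]_n := (2^-1 *: (2^-1 *: A) + ((1 - 2^-1) / (1 + sigma)) *: A)%R.
have mcone := measurable_frob_cone A gamma.
have : mu (@frob_ball R n) <=
    mu ((fun a : 'M[R]_n => c *: a + v)%R @^-1` frob_cone A gamma).
  apply: le_measure; rewrite ?inE.
  - exact: measurable_frob_ball.
  - exact: (measurable_preimageT (measurable_mx_affine c v)).
  - move=> a a1 /=; have := @frob_cone_contract R n A (2^-1 *: A)%R a sigma 1%R (2^-1)%R
      A1 s01 cone0 a1 _ h01.
    rewrite scale1r addrA -/v -/c (addrC v); apply.
    by rewrite lexx andbT; lra.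
move=> /(lt_le_trans (lebesgue_frob_ball_gt0 n0)).
rewrite lebesgue_mx_affine// pmule_rgt0//.
by rewrite lte_fin exprn_gt0// invr_gt0.
Qed.

End ball_volume.

(** * Growth of a form around a point *)

Lemma bin_leq_exp d k : ('C(d, k) <= d ^ k)%N.
Proof.
apply: (@leq_trans (d ^_ k)).
  by rewrite -bin_ffact leq_pmulr// fact_gt0.
elim: k => [|k IH]; first by rewrite ffactn0.
by rewrite ffactnSr expnSr leq_mul// leq_subr.
Qed.

Lemma seq_arg_min (T : eqType) (K : realDomainType) (g : T -> K) (s : seq T) : s != [::] ->
  exists2 x, x \in s & forall y, y \in s -> g x <= g y.
Proof.
elim: s => // x s IH _; have [->|/IH[y ys ymin]] := eqVneq s [::].
  by exists x; rewrite ?inE// => y; rewrite inE => /eqP ->.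
have [gxy|gyx] := leP (g x) (g y).
  exists x; rewrite ?inE ?eqxx// => z; rewrite inE => /predU1P[->//|/ymin].
  exact: le_trans.
exists y; rewrite ?inE ?ys ?orbT// => z; rewrite inE => /predU1P[->|/ymin//].
exact: ltW.
Qed.

Section log_bump_theory.
Variable R : realType.
Local Open Scope ereal_scope.

Lemma log_bump_ge0 (b x : R) : 0 <= log_bump b x.
Proof. exact: measure_ge0. Qed.

Lemma log_bumpZ (b c x : R) : c != 0%R ->
  log_bump b (c * x)%R = log_bump (b / `|c|)%R x.
Proof.
move=> c0; congr (lebesgue_measure _); apply/seteqP; split => y /= [-> yb].
  by split => //; rewrite mulrAC ler_pdivlMr ?normr_gt0// mulrC -normrM.
by split => //; move: yb; rewrite mulrAC ler_pdivlMr ?normr_gt0// mulrC -normrM.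
Qed.

Lemma le_sum_log_bump (b t : R) (xs : seq R) x : x \in xs ->
  log_bump b (t - x)%R <= \sum_(x <- xs) log_bump b (t - x)%R.
Proof.
elim: xs => // y xs IH; rewrite inE big_cons => /predU1P[->|/IH xxs].
  by rewrite leeDl// sume_ge0// => z _; exact: log_bump_ge0.
by rewrite (le_trans xxs)// leeDr// log_bump_ge0.
Qed.

Lemma sum_log_bump_pole (b : R) (xs : seq R) x : (0 < b)%R -> x \in xs ->
  \sum_(y <- xs) log_bump b (x - y)%R = +oo.
Proof.
move=> b0 /(le_sum_log_bump b x); rewrite subrr log_bump0// leye_eq.
by move/eqP.
Qed.

Lemma integral_sum_log_bump (b : R) (xs : seq R) : (0 < b)%R ->
  \int[lebesgue_measure]_(s in `[(-1)%R, 1%R])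
    (\sum_(x <- xs) log_bump b (s - x)%R) <= (2 * ((size xs)%:R * b))%:E.
Proof.
move=> b0; have mb (x : R) : measurable_fun (`[(-1)%R, 1%R]%classic : set (measurableTypeR R))
    (fun s : measurableTypeR R => log_bump b (s - x)%R).
  by apply: measurable_funTS; exact: measurable_log_bump.
rewrite (@ge0_integral_sum _ _ _ _ _ (@measurable_segment R) _ _ mb)//.
apply: (@le_trans _ _ (\sum_(x <- xs) (2 * b)%:E)).
  apply: lee_sum => x _; rewrite -(@integral_log_bump R b x)//.
  apply: ge0_subset_integral => //; first exact: measurable_log_bump.
by rewrite sumEFin lee_fin big_const_seq count_predT iter_addr_0 -[leLHS]mulr_natl mulrCA.
Qed.

End log_bump_theory.

Section growth.
Variables (R : realType) (J : Type) (d : nat) (F : seq (R * seq J)).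
Hypothesis Fd : form_degree d F.
Implicit Types (x y u b : J -> R).

(* For f = form_eval F and c_k the coefficient of t^k in f(x + t y), this is
   max(0, max_k (1/k) ln |c_k / c_0| - ln Y). *)
Definition growth (Y : R) x y : \bar R :=
  if (form_line F x y)`_0 == 0 then +oo%E
  else (\big[Num.max/0]_(k < d)
    (ln (`|(form_line F x y)`_k.+1 / (form_line F x y)`_0| / Y ^+ k.+1)
     / k.+1%:R))%:E.

Lemma growth_ge0 Y x y : (0 <= growth Y x y)%E.
Proof.
rewrite /growth; case: ifPn => // _; rewrite lee_fin.
by elim/big_rec: _ => // i z _ z0; rewrite le_max z0 orbT.
Qed.

Lemma growth_ge Y x y k : (form_line F x y)`_0 != 0 -> (0 < k <= d)%N ->
  ((ln (`|(form_line F x y)`_k / (form_line F x y)`_0| / Y ^+ k) / k%:R)%:E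
   <= growth Y x y)%E.
Proof.
move=> c0; case: k => // k /= kd; rewrite /growth (negbTE c0) lee_fin.
exact: (le_bigmax _ _ (Ordinal kd)).
Qed.

Lemma growth_le Y x y (S : \bar R) : (form_line F x y)`_0 != 0 -> (0 <= S)%E ->
  (forall k, (0 < k <= d)%N ->
    ((ln (`|(form_line F x y)`_k / (form_line F x y)`_0| / Y ^+ k) / k%:R)%:E
     <= S)%E) ->
  (growth Y x y <= S)%E.
Proof.
move=> c0 S0 kS; rewrite /growth (negbTE c0).
elim/big_ind: _ => // [u v uS vS|k _]; last by apply: kS; rewrite ltn_ord.
by rewrite /Num.max; case: ifP.
Qed.

(* Near a point of the line at distance r from the real parts of the roots of
   the restriction of f to the line, |c_k / c_0| <= (d / r)^k. *)
Lemma growth_line_le Y x y (t : R) (xs : seq R) : 0 < Y -> (0 < d)%N ->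
  size xs = d ->
  (forall s, `|form_eval F y| * \prod_(z <- xs) `|s - z| <= `|(form_line F x y).[s]|) ->
  (forall s r k, 0 < r -> (forall z, z \in xs -> r <= `|s - z|) ->
      `|(form_line F x y \Po ('X + s%:P))`_k| * r ^+ k <=
      'C(size xs, k)%:R * `|(form_line F x y).[s]|) ->
  form_eval F y != 0 ->
  (growth Y (fun j => (x j + t * y j)%R) y <=
   \sum_(z <- xs) log_bump (d%:R / Y) (t - z)%R)%E.
Proof.
move=> Y0 d0 sxs lower taylor fy0.
have b0 : 0 < d%:R / Y by rewrite divr_gt0// ltr0n.
have [|txs] := boolP (t \in xs).
  by move=> /(sum_log_bump_pole b0) ->; exact: leey.
set S := (\sum_(z <- xs) _)%E.
have S0 : (0 <= S)%E by apply: sume_ge0 => z _; exact: log_bump_ge0.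
have c0E : (form_line F (fun j => x j + t * y j) y)`_0 = (form_line F x y).[t].
  by rewrite form_line0 -horner_form_line.
have c0 : (form_line F x y).[t] != 0.
  rewrite -normr_gt0 (lt_le_trans _ (lower t))// mulr_gt0 ?normr_gt0//.
  rewrite big_seq prodr_gt0// => z zxs.
  rewrite normr_gt0 subr_eq0.
  by apply: contraNneq txs => ->.
(* The bump of the nearest real part alone will dominate the growth; the other bumps are
   nonnegative. *)
have [z zxs zmin] : exists2 z, z \in xs & forall w, w \in xs -> `|t - z| <= `|t - w|.
  by apply: (@seq_arg_min R R (fun w => `|t - w|)); rewrite -size_eq0 sxs -lt0n.
set r := `|t - z| in zmin.
have tz : t - z != 0 by rewrite subr_eq0; apply: contraNneq txs => ->.
have r0 : 0 < r by rewrite normr_gt0.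
have zS : ((ln (d%:R / Y / r))%:E <= S)%E.
  exact: (le_trans (log_bump_ge b0 tz) (le_sum_log_bump _ _ zxs)).
apply: growth_le => //; first by rewrite c0E.
move=> k /andP[k0 kd]; rewrite c0E form_line_shift.
have k0' : 0 < k%:R :> R by rewrite ltr0n.
set c := (_ \Po _)`_k.
(* By convention [ln 0] is 0, so for a vanishing coefficient [0 <= S] suffices. *)
have [->|cn0] := eqVneq c 0; first by rewrite mul0r normr0 mul0r ln0// mul0r.
apply: le_trans zS; rewrite lee_fin ler_pdivrMr// mulr_natr -lnXn; last first.
  by rewrite divr_gt0.
have q0 : 0 < `|c / (form_line F x y).[t]| / Y ^+ k.
  by rewrite divr_gt0 ?exprn_gt0// normr_gt0 mulf_neq0// invr_eq0.
rewrite ler_ln ?posrE// ?exprn_gt0 ?divr_gt0 ?ltr0n//.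
rewrite !expr_div_n mulrAC ler_pM2r ?invr_gt0 ?exprn_gt0//.
rewrite normrM normfV ler_pdivlMr ?exprn_gt0// mulrAC ler_pdivrMr ?normr_gt0//.
rewrite (le_trans (taylor t r k r0 zmin))// ler_wpM2r//.
by rewrite sxs -natrX ler_nat bin_leq_exp.
Qed.

Lemma measurable_form_line d' (T : measurableType d') (X Z : T -> J -> R) k :
  (forall j, measurable_fun setT (X ^~ j)) ->
  (forall j, measurable_fun setT (Z ^~ j)) ->
  measurable_fun setT (fun t => (form_line F (X t) (Z t))`_k).
Proof.
move=> mX mZ.
have mm s : forall l, measurable_fun setT (fun t => (monomial_line s (X t) (Z t))`_l).
  elim: s => [|j s IH] l.
    rewrite (_ : (fun _ => _) = cst (l == 0%N)%:R); first exact: measurable_cst.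
    by apply/funext => t; rewrite /monomial_line big_nil coef1.
  rewrite (_ : (fun _ => _) = fun t => X t j * (monomial_line s (X t) (Z t))`_l +
      Z t j * (if l is l'.+1 then (monomial_line s (X t) (Z t))`_l' else 0)).
    apply: measurable_funD; apply: measurable_funM => //.
    by case: l => [|l]; [exact: measurable_cst|exact: IH].
  by apply/funext => t; rewrite monomial_line_cons coef_linear_mul.
rewrite (_ : (fun _ => _) = fun t =>
    \sum_(m <- F) m.1 * (monomial_line m.2 (X t) (Z t))`_k).
  apply: measurable_sum => m; apply: measurable_funM => //.
by apply/funext => t; rewrite coef_form_line.
Qed.

Lemma measurable_growth d' (T : measurableType d') Y (X Z : T -> J -> R) :
  (forall j, measurable_fun setT (X ^~ j)) ->
  (forall j, measurable_fun setT (Z ^~ j)) ->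
  measurable_fun setT (fun t => growth Y (X t) (Z t)).
Proof.
move=> mX mZ; have mc k := measurable_form_line k mX mZ.
apply: measurable_fun_ifT.
- exact: measurable_fun_eqr.
- exact: measurable_cst.
- apply/measurable_EFinP; elim: (index_enum _) => [|k s IH].
    rewrite (_ : (fun _ => _) = cst 0); first exact: measurable_cst.
    by apply/funext => t; rewrite big_nil.
  (* The inverse of the denominator is written as the real power [-1] of its absolute value, which
     is a measurable function. *)
  rewrite (_ : (fun _ => _) = (fun t =>
    (ln ((`|(form_line F (X t) (Z t))`_k.+1| * (`|(form_line F (X t) (Z t))`_0| `^ (-1)))
      * (Y ^+ k.+1)^-1) * (k.+1%:R)^-1)) \max (fun t => \big[Num.max/0]_(k <- s)
    (ln (`|(form_line F (X t) (Z t))`_k.+1 / (form_line F (X t) (Z t))`_0| / Y ^+ k.+1)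
     / k.+1%:R))); last first.
    by apply/funext => t; rewrite big_cons/= powR_inv1// normrM normfV.
  apply: measurable_maxr => //; apply: measurable_funM => //.
  apply: (measurableT_comp (@measurable_ln R)).
  apply: measurable_funM => //.
  apply: measurable_funM.
    exact: (measurableT_comp (@normr_measurable R setT)).
  apply: (measurableT_comp (@measurable_powR R (-1))).
  exact: (measurableT_comp (@normr_measurable R setT)).
Qed.

(** As [form_eval F y] is the leading coefficient, the restriction to the line has exactly [d]
    roots. Each contributes a bump of integral at most [2 d / (Y |c|)]. *)
Lemma integral_growth_line_le Y x y (c : R) : 0 < Y -> (0 < d)%N -> c != 0 ->
  form_eval F y != 0 ->
  (\int[lebesgue_measure]_(s in `[(-1)%R, 1%R])
     growth Y (fun j => (x j + s * c * y j)%R) y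
   <= (2 * (d%:R ^+ 2 / (Y * `|c|)))%:E)%E.
Proof.
move=> Y0 d0 c0 fy0; pose p := form_line F x y.
have pd : p`_d = form_eval F y by exact: form_line_lead.
have sp : size p = d.+1.
  apply/eqP; rewrite eqn_leq size_form_line//= ltnNge; apply/negP => /leq_sizeP.
  by move=> /(_ d (leqnn d)) /eqP; rewrite pd (negbTE fy0).
have p0 : p != 0 by rewrite -size_poly_gt0 sp.
have [xs [sxs lower taylor]] := real_poly_roots p0.
rewrite sp/= in sxs; rewrite lead_coefE sp pd/= in lower.
have b0 : 0 < d%:R / (Y * `|c|) by rewrite divr_gt0 ?ltr0n// mulr_gt0// normr_gt0.
have := @integral_sum_log_bump R _ [seq z / c | z <- xs] b0.
rewrite size_map sxs.
have -> : d%:R * (d%:R / (Y * `|c|)) = d%:R ^+ 2 / (Y * `|c|).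
  by rewrite expr2 mulrA.
apply: le_trans; apply: ge0_le_integral => //.
- by move=> s _; exact: growth_ge0.
- apply: measurable_funTS; apply: measurable_growth => j //.
  by apply: measurable_funD => //; do 2 apply: measurable_funM => //.
- apply: measurable_funTS; apply: emeasurable_sum => z.
  exact: measurable_log_bump.
- move=> s _; apply: (le_trans (growth_line_le (s * c) Y0 d0 sxs lower taylor fy0)).
  rewrite big_map le_eqVlt; apply/orP; left; apply/eqP; apply: eq_bigr => z _.
  (* The speed [c] on the line divides the real parts by [c] and the width of the bumps by [|c|]. *)
  rewrite (_ : s * c - z = c * (s - z / c)); last by field.
  by rewrite log_bumpZ// invfM mulrA.
Qed.

End growth.

Lemma form_line_scale_dir (R : comNzRingType) (J : Type) (F : seq (R * seq J))
    (x w : J -> R) (t : R) k :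
  (form_line F x (fun j => t * w j))`_k = t ^+ k * (form_line F x w)`_k.
Proof.
rewrite !coef_form_line mulr_sumr; apply: eq_bigr => m _; rewrite mulrCA.
congr (_ * _); elim: m.2 k => [|j s IH] k.
  rewrite /monomial_line !big_nil coef1; case: k => [|k]; last by rewrite mulr0.
  by rewrite expr0 mul1r.
rewrite !monomial_line_cons !coef_linear_mul IH.
case: k => [|k]; first by rewrite !mulr0 !addr0; ring.
by rewrite IH exprS; ring.
Qed.

(** * Lower bound for the growth near a zero of the form *)

Section distance_to_zero.
Variables (R : realType) (J : Type) (d : nat) (F : seq (R * seq J)).
Hypothesis Fd : form_degree d F.
Implicit Types (x u b : J -> R).

Lemma sum_halves m : \sum_(k < m) (2^-1 : R) ^+ k.+1 = 1 - 2^-1 ^+ m.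
Proof.
elim: m => [|m IH]; first by rewrite big_ord0 expr0 subrr.
by rewrite big_ord_recr/= IH exprS; field.
Qed.

(** Otherwise the terms of positive degree at [e] would add up to at most [(1 - 2^-d) |f(x)|], too
    little to cancel the constant term. *)
Lemma zero_large_coef x u (e : R) : 0 < e ->
  form_eval F x != 0 -> form_eval F (fun j => x j + e * u j) = 0 ->
  exists2 k, (0 < k <= d)%N &
    2^-1 ^+ k * `|form_eval F x| <= `|(form_line F x u)`_k| * e ^+ k.
Proof.
move=> e0 fx0 fe0; apply: contrapT => noK.
have small (k : 'I_d) : `|(form_line F x u)`_k.+1 * e ^+ k.+1| <=
    2^-1 ^+ k.+1 * `|form_eval F x|.
  rewrite leNgt; apply/negP => kbig; apply: noK; exists k.+1; first exact: ltn_ord.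
  by rewrite ltW// -[X in _ * X ^+ _](gtr0_norm e0) -normrX -normrM.
move: fe0; rewrite -horner_form_line (horner_coef_wide _ (size_form_line x u Fd)).
rewrite big_ord_recl/= expr0 mulr1 form_line0 => /eqP; rewrite addr_eq0 => /eqP fE.
have : `|form_eval F x| <= (1 - 2^-1 ^+ d) * `|form_eval F x|.
  rewrite {1}fE normrN (le_trans (ler_norm_sum _ _ _))// -sum_halves mulr_suml.
  by apply: ler_sum => k _; exact: small.
rewrite mulrBl mul1r lerBDl gerDr leNgt mulr_gt0 ?exprn_gt0 ?normr_gt0//.
Qed.

(** For the index [k] of [zero_large_coef], the coefficient along the directions [b + s t u] is a
    polynomial in [s] of degree [k] with leading coefficient [t^k c_k(x, u)]. It is at least its
    leading coefficient times the distances of [s] to the real parts of its roots, and the bumps pay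
    for the logarithms of these distances. *)
Lemma growth_near_zero (Y e t : R) x u : 0 < Y -> 0 < e -> 0 < t ->
  form_eval F x != 0 -> form_eval F (fun j => x j + e * u j) = 0 ->
  exists (k : nat) , (0 < k <= d)%N /\ forall b, exists2 xs : seq R, size xs = k &
    forall s, ((- ln e - ln 2 + ln t - ln Y)%:E <=
      growth d F Y x (fun j => (b j + s * (t * u j))%R) +
      k%:R^-1%:E * \sum_(z <- xs) log_bump 1 (s - z)%R)%E.
Proof.
move=> Y0 e0 t0 fx0 fe0.
have [k kd ck] := zero_large_coef e0 fx0 fe0.
exists k; split => // b; have /andP[k0 _] := kd.
have k0' : 0 < k%:R :> R by rewrite ltr0n.
set ell := (form_line F x u)`_k in ck.
have ell0 : 0 < `|ell|.
  rewrite -(pmulr_lgt0 _ (exprn_gt0 k e0)) (lt_le_trans _ ck)//.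
  by rewrite mulr_gt0 ?normr_gt0// exprn_gt0// invr_gt0.
have [q [sq qk qE]] := form_line_poly F x b (fun j => t * u j) k.
rewrite form_line_scale_dir -/ell in qk.
have qk0 : q`_k != 0.
  by rewrite qk mulf_neq0 ?expf_neq0 ?(gt_eqF t0)//; rewrite -normr_gt0.
have sqE : size q = k.+1.
  apply/eqP; rewrite eqn_leq sq ltnNge; apply/negP => /leq_sizeP.
  by move=> /(_ k (leqnn k)) /eqP; rewrite (negbTE qk0).
have q0 : q != 0 by rewrite -size_poly_gt0 sqE.
have [xs [sxs lower _]] := real_poly_roots q0.
rewrite sqE/= in sxs; rewrite lead_coefE sqE/= qk in lower.
exists xs => // s; set y := fun j => _.
have kpos : (0 < k%:R^-1%:E :> \bar R)%E by rewrite lte_fin invr_gt0.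
have [sxsi|sxsi] := boolP (s \in xs).
  rewrite (sum_log_bump_pole ltr01 sxsi) gt0_muley// addey ?leey//.
  by rewrite gt_eqF// (lt_le_trans _ (growth_ge0 _ _ _ _ _)).
have prod0 : 0 < \prod_(z <- xs) `|s - z|.
  rewrite big_seq prodr_gt0// => z zxs; rewrite normr_gt0 subr_eq0.
  by apply: contraNneq sxsi => ->.
have qs0 : 0 < `|q.[s]|.
  rewrite (lt_le_trans _ (lower s))// mulr_gt0// normrM mulr_gt0//.
  by rewrite normr_gt0 expf_neq0// gt_eqF.
have c0E : (form_line F x y)`_0 = form_eval F x by rewrite form_line0.
have fx0' : 0 < `|form_eval F x| by rewrite normr_gt0.
have := @growth_ge R J d F Y x y k; rewrite c0E -qE => /(_ fx0 kd).
move=> h1; have h2 : (\sum_(z <- xs) (ln (1 / `|s - z|))%:E <=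
    \sum_(z <- xs) log_bump 1 (s - z)%R)%E.
  rewrite !big_seq; apply: lee_sum => z zxs; apply: log_bump_ge => //.
  by rewrite subr_eq0; apply: contraNneq sxsi => ->.
apply: le_trans (leeD h1 (lee_wpmul2l (ltW kpos) h2)).
rewrite sumEFin -EFinM -EFinD lee_fin.
have lnprod : \sum_(z <- xs) ln (1 / `|s - z|) = - ln (\prod_(z <- xs) `|s - z|).
  have {prod0 lower sxs qs0 h1 h2} : forall zs, s \notin zs ->
      0 < \prod_(z <- zs) `|s - z| /\
      \sum_(z <- zs) ln (1 / `|s - z|) = - ln (\prod_(z <- zs) `|s - z|).
    elim => [|z zs IH]; first by rewrite !big_nil ln1 oppr0.
    rewrite inE negb_or => /andP[sz /IH[p0 pE]].
    have z0 : 0 < `|s - z| by rewrite normr_gt0 subr_eq0.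
    rewrite !big_cons mulr_gt0// pE; split => //.
    by rewrite [in RHS]lnM ?posrE// div1r lnV ?posrE// opprD.
  by move=> /(_ _ sxsi) [].
rewrite lnprod (mulrC k%:R^-1) -mulrDl ler_pdivlMr//.
have -> : (- ln e - ln 2 + ln t - ln Y) * k%:R =
    ln (t ^+ k) - ln (e ^+ k) + ln (2^-1 ^+ k) - ln (Y ^+ k).
  have lnX z : 0 < z -> ln (z ^+ k) = ln z * k%:R :> R.
    by move=> z0; rewrite lnXn// mulr_natr.
  by rewrite !lnX ?invr_gt0// lnV ?posrE//; ring.
have Yk : 0 < Y ^+ k by exact: exprn_gt0.
have ek : 0 < e ^+ k by exact: exprn_gt0.
have tk : 0 < t ^+ k by exact: exprn_gt0.
have hk : 0 < (2^-1 : R) ^+ k by rewrite exprn_gt0// invr_gt0.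
rewrite normrM normfV !ln_div ?posrE ?divr_gt0 ?mulr_gt0//.
set P := \prod_(z <- xs) _ in prod0 lower *.
(* What remains is the sum of two logarithmic inequalities: the lower bound for [q] at [s], and the
   size of [ell] given by the zero at distance [e]. *)
have : ln (t ^+ k * `|ell| * P) <= ln `|q.[s]|.
  rewrite ler_ln ?posrE ?mulr_gt0//.
  by have := lower s; rewrite normrM (gtr0_norm tk).
have : ln (2^-1 ^+ k * `|form_eval F x|) <= ln (`|ell| * e ^+ k).
  by rewrite ler_ln ?posrE ?mulr_gt0.
rewrite !lnM ?posrE ?mulr_gt0//; lra.
Qed.

End distance_to_zero.

(** * Growth of a form on matrices *)

Section matrix_growth.
Variables (R : realType) (m d : nat) (F : seq (R * seq ('I_m * 'I_m))).
Hypothesis Fd : form_degree d F.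
Implicit Types (A B M Z a b : 'M[R]_m) (C : set 'M[R]_m).
Notation mu := (@lebesgue_mx R m m).
Notation leb := (@lebesgue_measure R).

Definition entries A : 'I_m * 'I_m -> R := fun p => A p.1 p.2.

Definition mx_form A : R := form_eval F (entries A).

Definition mx_growth (Y : R) A a : \bar R := growth d F Y (entries A) (entries a).

Lemma mx_growth_ge0 Y A a : (0 <= mx_growth Y A a)%E.
Proof. exact: growth_ge0. Qed.

Lemma measurable_mx_growth Y d' (T : measurableType d') (f g : T -> 'M[R]_m) :
  measurable_fun setT f -> measurable_fun setT g ->
  measurable_fun setT (fun t => mx_growth Y (f t) (g t)).
Proof.
move=> mf mg; apply: measurable_growth => -[i j].
  exact: (measurableT_comp (measurable_mx_entry i j) mf).
exact: (measurableT_comp (measurable_mx_entry i j) mg).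
Qed.

Lemma mx_growth_zero Y A a : mx_form A = 0 -> mx_growth Y A a = +oo%E.
Proof. by rewrite /mx_growth /growth form_line0 /mx_form => ->; rewrite eqxx. Qed.

(** The degree in the base point of the coefficient of index [k] is [d - k], so dividing [A] by [l]
    multiplies the ratio [c_k / c_0] by [l^k <= 1]. This compares a point of the cone with its
    radial projection. *)
Lemma mx_growth_scale Y (l : R) A a : 0 < Y -> 0 < l <= 1 ->
  (mx_growth Y (l^-1 *: A) a <= mx_growth Y A a)%E.
Proof.
move=> Y0 /andP[l0 l1]; have [A0|A0] := eqVneq (mx_form A) 0.
  by rewrite (mx_growth_zero _ _ A0) leey.
have coefE k : (k <= d)%N -> (form_line F (entries (l^-1 *: A)) (entries a))`_k =
    l^-1 ^+ (d - k) * (form_line F (entries A) (entries a))`_k.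
  move=> kd; rewrite -(form_line_scale _ _ _ Fd kd).
  by congr (form_line F _ _)`_k; apply/funext => p; rewrite /entries mxE.
have lV0 i : l^-1 ^+ i != 0 by rewrite expf_neq0// invr_eq0 gt_eqF.
have c0 : (form_line F (entries A) (entries a))`_0 != 0 by rewrite form_line0.
have c0' : (form_line F (entries (l^-1 *: A)) (entries a))`_0 != 0.
  by rewrite coefE// mulf_neq0.
apply: growth_le => //; first exact: mx_growth_ge0.
move=> k kd; apply: le_trans (growth_ge _ c0 kd).
have /andP[k0 kd'] := kd; rewrite lee_fin ler_wpM2r ?invr_ge0//.
rewrite !coefE// subn0.
set ck := _`_k; set cc := _`_0 in c0 *.
have [->|ck0] := eqVneq ck 0; first by rewrite mulr0 !mul0r.
have -> : l^-1 ^+ (d - k) * ck / (l^-1 ^+ d * cc) = l ^+ k * (ck / cc).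
  rewrite -[in X in _ / (X * _)](subnK kd') exprD.
  have lk : l ^+ k != 0 by rewrite expf_neq0// gt_eqF.
  by rewrite !exprVn; field; rewrite c0 lk expf_neq0// gt_eqF.
have q0 : 0 < `|ck / cc| by rewrite normr_gt0 mulf_neq0// invr_eq0.
have Yk : 0 < Y ^+ k by exact: exprn_gt0.
have lk0 : 0 < l ^+ k by exact: exprn_gt0.
rewrite normrM (gtr0_norm lk0) ler_ln ?posrE ?divr_gt0 ?mulr_gt0//.
rewrite ler_pM2r ?invr_gt0// ler_piMl// exprn_ile1//; exact: ltW.
Qed.

Lemma integral_mx_growth_le C (k c Y : R) (p q : 'M[R]_m) a :
  0 < k -> 0 < Y -> (0 < d)%N -> c != 0 -> measurable C ->
  (forall M (s : R), C M -> `[(-1)%R, 1%R]%classic s ->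
     C (k *: M + (p + s *: q))) ->
  q = (k * c) *: a -> mx_form a != 0 ->
  (\int[mu]_(M in C) mx_growth Y M a <=
   (k^-1 ^+ (m * m) * (d%:R ^+ 2 / (Y * `|c|)))%:E * mu C)%E.
Proof.
move=> k0 Y0 d0 c0 mC CC qE fa0; apply: (averaging k0 _ mC CC) => //.
- by rewrite divr_ge0 ?exprn_ge0// mulr_ge0// ltW.
- by apply: measurable_mx_growth; [exact: measurable_id|exact: measurable_cst].
- by move=> M; exact: mx_growth_ge0.
(* [averaging] moves along [- k^-1 q], which is [- c a]; only [|c|] enters the bound. *)
- move=> M; have := integral_growth_line_le Fd (entries M) Y0 d0 (_ : - c != 0) fa0.
  rewrite oppr_eq0 normrN => /(_ c0); apply: le_trans.
  rewrite le_eqVlt; apply/orP; left; apply/eqP; apply: eq_integral => s _.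
  congr growth; apply/funext => ij; rewrite /entries !mxE qE !mxE mulrA.
  by field; rewrite gt_eqF.
Qed.

(* Averaging growth_near_zero over s in [-1, 1], then over a in the ball. *)
Lemma ln_dist_le_growth (Y k : R) Z B : 0 < Y -> 0 < k < 1 -> (0 < d)%N ->
  mx_form Z != 0 -> mx_form B = 0 ->
  ((- ln (frob_norm (Z - B)) - ln 2 + ln (1 - k) - ln Y - 1)%:E
     * mu (@frob_ball R m) <=
   (k^-1 ^+ (m * m))%:E * \int[mu]_(a in @frob_ball R m) mx_growth Y Z a)%E.
Proof.
move=> Y0 /andP[k0 k1] d0 fZ fB; set e := frob_norm (Z - B).
have e0 : 0 < e.
  rewrite lt_neqAle frob_norm_ge0 andbT eq_sym; apply/eqP => /frob_norm_eq0.
  by move/eqP; rewrite subr_eq0 => /eqP ZB; move: fZ; rewrite ZB fB eqxx.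
set D := (- ln e - ln 2 + ln (1 - k) - ln Y).
have K0 : (0 <= mu (@frob_ball R m))%E by exact: measure_ge0.
have mK := @measurable_frob_ball R m.
have kN0 : 0 <= k^-1 ^+ (m * m) by rewrite exprn_ge0// invr_ge0 ltW.
(* If [D - 1] is nonpositive, the signs suffice; otherwise the constants integrated below are
   nonnegative. *)
have [D1|D1] := leP (D - 1) 0.
  rewrite (@le_trans _ _ 0%E)//; first by rewrite mule_le0_ge0// lee_fin.
  by rewrite mule_ge0 ?lee_fin// integral_ge0// => a _; exact: mx_growth_ge0.
(* The unit direction from [Z] to [B], so that [B] is [Z + e u]. *)
pose u := e^-1 *: (B - Z).
have u1 : @frob_ball R m u.
  rewrite /frob_ball/= frob_normZ gtr0_norm ?invr_gt0// -opprB frob_normN.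
  by rewrite mulVf// gt_eqF.
have fe0 : form_eval F (fun p => entries Z p + e * entries u p) = 0.
  rewrite -[RHS]fB; congr form_eval; apply/funext => p.
  by rewrite /entries !mxE; field; rewrite gt_eqF.
have t0 : 0 < 1 - k by rewrite subr_gt0.
have [l [/andP[l0 _] near]] := growth_near_zero Fd Y0 e0 t0 fZ fe0.
pose I : set (measurableTypeR R) := `[(-1)%R, 1%R]%classic.
have mI : measurable I := @measurable_segment R.
have iI (r : \bar R) : (\int[leb]_(s in I) cst r s = r * 2%:E)%E.
  by rewrite integral_cst//; congr (_ * _)%E; exact: lebesgue_segment.
pose g (z : measurableTypeR R * 'M[R]_m) :=
  mx_growth Y Z (k *: z.2 + (0 + z.1 *: ((1 - k) *: u))).
have mg : measurable_fun setT g.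
  apply: measurable_mx_growth; first exact: measurable_cst.
  apply: measurable_fun_mx => i j.
  have m2 : measurable_fun setT (fun z : measurableTypeR R * 'M[R]_m => z.2 i j).
    exact: (measurableT_comp (measurable_mx_entry i j) measurable_snd).
  have m1 : measurable_fun setT (fun z : measurableTypeR R * 'M[R]_m => z.1 : R).
    exact: measurable_fst.
  have -> : (fun z : measurableTypeR R * 'M[R]_m =>
      (k *: z.2 + (0 + z.1 *: ((1 - k) *: u))) i j) =
      (fun z => k * z.2 i j + z.1 * ((1 - k) * u i j)).
    by apply/funext => z; rewrite !mxE add0r.
  exact: (measurable_funD (measurable_funM (measurable_cst _) m2)
    (measurable_funM m1 (measurable_cst _))).
have g0 z : (0 <= g z)%E by exact: mx_growth_ge0.
have step a : ((2 * (D - 1))%:E <= \int[leb]_(s in I) g (s, a))%E.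
  have [xs sxs bound] := near (fun p => k * entries a p).
  have mgs : measurable_fun I (fun s => g (s, a)).
    by apply: measurable_funTS; exact: (measurable_fun_pair1 a mg).
  have mb : measurable_fun I (fun s : R => \sum_(z <- xs) log_bump 1 (s - z)%R)%E.
    by apply: measurable_funTS; apply: emeasurable_sum => z; exact: measurable_log_bump.
  have : (\int[leb]_(s in I) (cst D%:E s) <= \int[leb]_(s in I)
     (g (s, a) + l%:R^-1%:E * \sum_(z <- xs) log_bump 1 (s - z)%R))%E.
    apply: ge0_le_integral => //.
    - by move=> s _; rewrite lee_fin; lra.
    - apply: emeasurable_funD; first exact: mgs.
      exact: measurable_funeM.
    - move=> s _ /=; apply: le_trans (bound s) _; apply: leeD => //.
      rewrite le_eqVlt; apply/orP; left; apply/eqP; congr growth.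
      by apply/funext => p; rewrite /entries !mxE add0r.
  rewrite iI ge0_integralD//; last 2 first.
  - move=> s _; rewrite mule_ge0// ?lee_fin ?invr_ge0//.
    by apply: sume_ge0 => z _; exact: log_bump_ge0.
  - exact: measurable_funeM.
  have linv : (0 <= l%:R^-1%:E :> \bar R)%E by rewrite lee_fin invr_ge0.
  rewrite ge0_integralZl//; last first.
    by move=> s _; apply: sume_ge0 => z _; exact: log_bump_ge0.
  have hb := lee_wpmul2l linv (integral_sum_log_bump xs (@ltr01 R)).
  (* The [l] bumps of width 1, weighted by [1 / l], integrate to at most 2 over a segment of length
     2: the mean loss is 1. *)
  have l2 : (l%:R^-1%:E * (2 * ((size xs)%:R * 1))%:E = 2%:E :> \bar R)%E.
    by rewrite -EFinM sxs mulr1 mulrCA mulVf ?mulr1// pnatr_eq0 -lt0n.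
  rewrite l2 in hb; move=> /le_trans /(_ (leeD (lexx _) hb)).
  rewrite -leeBlDr// -EFinM -EFinB; apply: le_trans.
  by rewrite lee_fin; lra.
have h1 : ((2 * (D - 1))%:E * mu (@frob_ball R m) <=
    \int[leb]_(s in I) \int[mu]_(a in @frob_ball R m) g (s, a))%E.
  rewrite (@fubini_tonelli_setX _ _ _ _ R leb mu I (@frob_ball R m) g mI mK mg g0) -integral_cst//.
  apply: ge0_le_integral => //.
  - by move=> a _; rewrite lee_fin mulr_ge0// ltW.
  - by apply: measurable_funTS; exact: (@measurable_fun_integral_in_swap _ _ _ _ R leb I g mI mg g0).
set G := (\int[mu]_(a in @frob_ball R m) mx_growth Y Z a)%E.
have mZ : measurable_fun setT (mx_growth Y Z).
  by apply: measurable_mx_growth; [exact: measurable_cst|exact: measurable_id].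
(* For each [s] the map [a |-> k a + s (1 - k) u] sends the ball into itself, so the shift
   disappears at the cost of [k^-1 ^+ (m * m)]. *)
have hs (s : R) : I s ->
    (\int[mu]_(a in @frob_ball R m) g (s, a) <= (k^-1 ^+ (m * m))%:E * G)%E.
  rewrite /I/= in_itv/= => Is.
  have contr a : frob_ball a -> frob_ball (k *: a + (0 + s *: ((1 - k) *: u))).
    by move=> a1; apply: frob_ball_contract => //; rewrite !ltW.
  exact: (ge0_integral_contract k0 mK contr mZ (mx_growth_ge0 Y Z)).
have h2 : (\int[leb]_(s in I) \int[mu]_(a in @frob_ball R m) g (s, a) <=
    \int[leb]_(s in I) (cst ((k^-1 ^+ (m * m))%:E * G) s))%E.
  apply: ge0_le_integral.
  - exact: mI.
  - by move=> s _; exact: integral_ge0.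
  - apply: measurable_funTS.
    exact: (@measurable_fun_integral_in _ _ _ _ R mu (@frob_ball R m) g mK mg g0).
  - exact: measurable_cst.
  - exact: hs.
have := le_trans h1 h2; rewrite iI.
by rewrite mulrC EFinM muleAC lee_pmul2r.
Qed.

End matrix_growth.

(** * The uniform measure on a spherical ball *)

Section integral_complements.
Local Open Scope ereal_scope.
Context d (T : measurableType d) (R : realType).
Implicit Types (mu : {measure set T -> \bar R}).

(* Unlike ge0_le_integral, no measurability is needed: the integral of a
   nonnegative function is a supremum over the simple functions below it. *)
Lemma ge0_le_integral_sup mu (f g : T -> \bar R) :
  (forall x, 0 <= f x) -> (forall x, f x <= g x) ->
  \int[mu]_x f x <= \int[mu]_x g x.
Proof.
move=> f0 fg; rewrite !ge0_integralTE//; last by move=> x; exact: le_trans (fg x).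
apply: ge_ereal_sup => _ [h hf <-]; apply: ereal_sup_ubound; exists h => // x.
exact: le_trans (hf x) (fg x).
Qed.

Lemma ge0_integral_mrestr mu (D : set T) (mD : measurable D) (f : T -> \bar R) :
  measurable_fun setT f -> (forall x, 0 <= f x) ->
  \int[mrestr mu mD]_x f x = \int[mu]_(x in D) f x.
Proof.
move=> mf f0; rewrite (@ge0_negligible_integral _ _ _ (mrestr mu mD) setT (~` D))//.
- rewrite setTD setCK; apply: eq_measure_integral => A mA AD.
  by rewrite /= /mrestr setIidl.
- exact: measurableC.
- by rewrite /= /mrestr setICl measure0.
Qed.

End integral_complements.

Section uniform_ball_theory.
Variables (R : realType) (n : nat) (A : 'M[R]_n) (sigma : R).
Hypotheses (n0 : (0 < n)%N) (A1 : frob_norm A = 1) (s01 : 0 < sigma <= 1).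
Notation mu := (@lebesgue_mx R n n).
Notation cone := (frob_cone A (Num.sqrt (1 - sigma ^+ 2))).
Local Open Scope ereal_scope.

Lemma lebesgue_frob_cone_fin : mu cone \is a fin_num.
Proof.
rewrite ge0_fin_numE ?measure_ge0//.
apply: le_lt_trans (@lebesgue_frob_ball_lty R n); apply: le_measure; rewrite ?inE.
- exact: measurable_frob_cone.
- exact: measurable_frob_ball.
- by move=> M [].
Qed.

(** The factor [n ^ 2] of the spherical volume cancels in the normalization. As the cone has
    positive finite volume, the Dirac default of [mnormalize] does not occur. *)
Lemma uniform_ballE (E : set 'M[R]_n) :
  uniform_ball A sigma E =
  (fine (mu cone))^-1%:E * mu (sphere_proj (n:=n) @^-1` E `&` cone).
Proof.
pose m : {measure set 'M[R]_n -> \bar R} :=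
  mrestr (@sphere_volume R n) (measurable_sphere_ball A sigma).
have restrE (S : set 'M[R]_n) :
    m S = (n ^ 2)%:R%:E * mu (sphere_proj (n:=n) @^-1` S `&` cone).
  rewrite /m /= /mrestr /sphere_volume; congr (_ * mu _).
  rewrite -(frob_cone_sphere_ball A1 s01); apply/seteqP; split => M /=.
    by move=> [? []].
  by move=> [? []].
have N0 : (0 < (n ^ 2)%:R :> R)%R by rewrite ltr0n expn_gt0 n0.
have c0 := lebesgue_frob_cone_gt0 n0 A1 s01.
have cE := fineK lebesgue_frob_cone_fin.
have fc0 : (0 < fine (mu cone))%R by rewrite -lte_fin cE.
have evE : m setT = ((n ^ 2)%:R * fine (mu cone))%:E.
  by rewrite restrE preimage_setT setTI EFinM cE.
have ev0 : (0 < (n ^ 2)%:R * fine (mu cone))%R by exact: mulr_gt0.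
rewrite -[LHS]/(mnormalize m \d_A E) /mnormalize evE !eqe orbF gt_eqF//.
rewrite restrE muleAC; congr (_ * _).
transitivity (((n ^ 2)%:R * ((n ^ 2)%:R * fine (mu cone))^-1)%R%:E); first by [].
by rewrite invfM mulrA mulfV ?mul1r// gt_eqF.
Qed.

(** The uniform measure is the image of the normalized Lebesgue measure on the cone under radial
    projection. *)
Lemma ge0_integral_uniform_ball (G : 'M[R]_n -> \bar R) :
  measurable_fun setT G -> (forall Z, 0 <= G Z) ->
  \int[uniform_ball A sigma]_Z G Z =
  (fine (mu cone))^-1%:E * \int[mu]_(M in cone) G (sphere_proj M).
Proof.
move=> mG G0; have c0 : (0 <= (fine (mu cone))^-1)%R.
  by rewrite invr_ge0 fine_ge0.
have mc := measurable_frob_cone A (Num.sqrt (1 - sigma ^+ 2)).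
pose P := measure_function_pushforward__canonical__measure_function_Measure
  (mrestr mu mc) (@measurable_sphere_proj R n).
transitivity (\int[mscale (NngNum c0) P]_Z G Z).
  by apply: eq_measure_integral => E mE _; exact: uniform_ballE.
rewrite ge0_integral_mscale//; congr (_ * _).
rewrite (@ge0_integral_pushforward _ _ _ _ _ _ (@measurable_sphere_proj R n))//.
rewrite preimage_setT ge0_integral_mrestr//.
  exact: (measurableT_comp mG (@measurable_sphere_proj R n)).
by move=> M; exact: G0.
Qed.

End uniform_ball_theory.

(** * Expectation of the logarithm of the condition number *)

Section eigenvalue_condition.
Variables (R : realType) (m : nat).
Local Notation n := m.+2.
Local Notation d := (n * m.+1)%N.
Implicit Types (A B M Z a : 'M[R]_n) (sigma : R).
Variable F : seq (R * seq ('I_n * 'I_n)).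
Hypothesis Fd : form_degree d F.
Hypothesis FE : forall A, trace_disc A = mx_form F A.
Notation mu := (@lebesgue_mx R n n).
Notation K := (@frob_ball R n).

Lemma multiple_eigen_form0 A : multiple_eigen A -> mx_form F A = 0.
Proof. by move=> [x /trace_disc_eq0]; rewrite FE. Qed.

Lemma multiple_eigen0 : multiple_eigen (0 : 'M[R]_n).
Proof.
exists 0; have -> : char_poly (0 : 'M[R]_n) = 'X^n.
  by rewrite /char_poly /char_poly_mx map_mx0 subr0 det_scalar.
by rewrite mup_geq ?monic_neq0 ?monicXn// subr0 dvdp_Pexp2l// size_polyX.
Qed.

(** The zero matrix has a multiple eigenvalue, so the distance is at most the norm. This makes the
    logarithm nonnegative, as [ge0_le_integral_sup] requires. *)
Lemma kappa_eigen_ge1 Z : (1 <= kappa_eigen Z)%E.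
Proof.
rewrite /kappa_eigen; case: ifPn => [_|Zn]; first exact: leey.
have Z0 : 0 < frob_norm Z.
  rewrite lt_neqAle frob_norm_ge0 andbT eq_sym; apply/eqP => /frob_norm_eq0 Z0.
  by move: Zn; rewrite Z0 => /negP; apply; rewrite inE; exact: multiple_eigen0.
have dist_le : (frob_dist Z (@multiple_eigen R n) <= (frob_norm Z)%:E)%E.
  apply: ereal_inf_lbound; exists 0; first exact: multiple_eigen0.
  by rewrite subr0.
have dist_ge : (0 <= frob_dist Z (@multiple_eigen R n))%E.
  by apply: le_ereal_inf_tmp => _ [B _ <-]; rewrite lee_fin frob_norm_ge0.
have s2 : 1 <= Num.sqrt 2 :> R by rewrite -[leLHS]sqrtr1 ler_sqrt// ler1n.
have sZ0 : 0 < Num.sqrt 2 * frob_norm Z by rewrite mulr_gt0// (lt_le_trans ltr01).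
move: dist_le dist_ge; case: (frob_dist _ _) => [r||]//.
(* A zero distance is treated apart: its inverse is [+oo]. *)
rewrite !lee_fin => rZ r0; rewrite inver; case: ifPn => [_|rn0].
  by rewrite gt0_muley ?lte_fin// leey.
have r0' : 0 < r by rewrite lt_neqAle eq_sym rn0.
rewrite -EFinM lee_fin ler_pdivlMr// mul1r (le_trans rZ)// ler_peMl//.
exact: ltW.
Qed.

Lemma exists_nonzero_form : exists2 g : 'M[R]_n, K g & mx_form F g != 0.
Proof.
pose D := diag_mx (\row_(i < n) i%:R : 'rV[R]_n).
have fD : mx_form F D != 0 by rewrite -FE; exact: trace_disc_neq0.
have D0 : 0 < frob_norm D.
  rewrite lt_neqAle frob_norm_ge0 andbT eq_sym; apply/eqP => /frob_norm_eq0 D0.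
  by move: fD; rewrite D0 (multiple_eigen_form0 multiple_eigen0) eqxx.
exists ((frob_norm D)^-1 *: D).
  by rewrite /frob_ball/= frob_normZ gtr0_norm ?invr_gt0// mulVf// gt_eqF.
rewrite /mx_form.
have -> : entries ((frob_norm D)^-1 *: D) = (fun p => (frob_norm D)^-1 * entries D p).
  by apply/funext => p; rewrite /entries mxE.
rewrite -(form_line0 _ _ (entries D)) (form_line_scale _ _ _ Fd)//.
by rewrite form_line0 mulf_neq0// expf_neq0// invr_eq0 gt_eqF.
Qed.

Lemma measurable_mx_form : measurable_fun setT (mx_form F).
Proof.
rewrite (_ : mx_form F = fun A => (form_line F (entries A) (entries A))`_0).
  by apply: measurable_form_line => -[i j]; exact: measurable_mx_entry.
by apply/funext => A; rewrite form_line0.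
Qed.

(** The growth in a direction [g] with nonzero form is [+oo] at every zero of the form, yet its
    integral over the ball is finite. *)
Lemma mx_form_null : mu (K `&` [set a | mx_form F a = 0]) = 0%E.
Proof.
have [g g1 fg] := exists_nonzero_form.
have h0 : 0 < (2^-1 : R) by rewrite invr_gt0.
set N := _ `&` _.
have mN : measurable N.
  apply: measurableI; first exact: measurable_frob_ball.
  by apply: (measurable_preimageT measurable_mx_form (measurable_set1 0)).
have contr M (s : R) : K M -> `[(-1)%R, 1%R]%classic s ->
     K (2^-1 *: M + (0 + s *: ((2^-1 * 1) *: g))).
  move=> M1; rewrite /= in_itv/= => s1.
  have -> : 2^-1 * 1 = 1 - 2^-1 :> R by lra.
  by apply: frob_ball_contract => //; lra.
have := @integral_mx_growth_le R n d F Fd K 2^-1 1 1 0 _ g h0 ltr01 _ (oner_neq0 _)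
  (@measurable_frob_ball R n) contr erefl fg.
move=> /(_ isT) intK.
have muKfin : mu K \is a fin_num.
  by rewrite ge0_fin_numE ?measure_ge0// lebesgue_frob_ball_lty.
have mg : measurable_fun setT (fun M => mx_growth d F 1 M g).
  by apply: measurable_mx_growth; [exact: measurable_id|exact: measurable_cst].
have : (\int[mu]_(M in N) mx_growth d F 1 M g < +oo)%E.
  apply: le_lt_trans (le_lt_trans intK _); last first.
    by rewrite -(fineK muKfin) -EFinM ltry.
  apply: ge0_subset_integral => //.
  - exact: measurable_frob_ball.
  - exact: measurable_funTS.
  - by move=> M _; exact: mx_growth_ge0.
  - by move=> M [].
rewrite (eq_integral (cst +oo%E)); last first.
  by move=> M; rewrite inE => -[_ fM]; rewrite mx_growth_zero.
rewrite integral_cst//; have [//|muN] := eqVneq (mu N) 0%E.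
by rewrite gt0_mulye ?ltxx// lt0e muN measure_ge0.
Qed.
End eigenvalue_condition.

(** * Numerical constants *)

Section log_constants.
Variable R : realType.

(** Since [exp(1/5) >= 6/5] and [(6/5)^4 > 2]. The value 4/5 makes [5/2 ln 2] at most 2. *)
Lemma ln2_le : ln 2 <= 4 / 5 :> R.
Proof.
rewrite -ler_expR lnK ?posrE//.
have h : 1 + 1 / 5 <= expR (1 / 5) :> R by exact: expR_ge1Dx.
have -> : expR (4 / 5) = expR (1 / 5) ^+ 4 :> R.
  by rewrite -expRM_natl; congr expR; field.
apply: le_trans (lerXn2r 4 _ _ h); rewrite ?nnegrE ?expR_ge0//; by lra.
Qed.

(** [Gamma], at most e, is the cost of one contraction; two are made, one over directions and one
    over the cone. [Y] is chosen so that the mean of the growth term is 1, which is the second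
    [+ 1]; the first comes from [ln_dist_le_growth]. *)
Lemma condition_constants (m : nat) (sigma : R) (n := m.+2) (N := (n * n)%N)
    (d := (n * m.+1)%N) (k := N%:R / N.+1%:R)
    (c := (1 - k) * sigma / (1 + sigma) / k)
    (Gamma := k^-1 ^+ N) (Y := Gamma * Gamma * (d%:R ^+ 2 / c)) :
  0 < sigma <= 1 ->
  1 <= Y /\
  ln (Num.sqrt 2) + ln 2 - ln (1 - k) + ln Y + 1 + 1 <=
    8 * ln n%:R + 2 * ln (1 / sigma) + 6.
Proof.
move=> /andP[s0 s1].
have n0 : 0 < n%:R :> R by rewrite ltr0n.
have N0 : 0 < N%:R :> R by rewrite ltr0n.
have NS0 : 0 < N.+1%:R :> R by rewrite ltr0n.
have d1 : 1 <= d%:R :> R by rewrite ler1n.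
have d0 : 0 < d%:R :> R by rewrite ltr0n.
have NS : N.+1%:R = N%:R + 1 :> R by rewrite natr1.
have t0 : 0 < 1 + sigma by rewrite addr_gt0.
have k1 : 1 - k = N.+1%:R^-1.
  by rewrite /k NS; field; rewrite -NS gt_eqF.
have cE : c = sigma / ((1 + sigma) * N%:R).
  rewrite /c k1 /k; field.
  by rewrite (gt_eqF N0) (gt_eqF t0) (addrC 1) -NS (gt_eqF NS0).
have c0 : 0 < c by rewrite cE divr_gt0// mulr_gt0.
have c1 : c <= 1.
  rewrite cE ler_pdivrMr ?mulr_gt0// mul1r (le_trans s1)//.
  by rewrite -[leLHS]mulr1 ler_pM ?ler1n//; lra.
have kV : k^-1 = 1 + N%:R^-1 by rewrite /k NS; field; rewrite gt_eqF -?NS ?gt_eqF.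
have kV1 : 1 <= k^-1 by rewrite kV lerDl invr_ge0 ltW.
have Gamma1 : 1 <= Gamma by rewrite exprn_ege1.
have Gamma0 : 0 < Gamma := lt_le_trans ltr01 Gamma1.
have Y1 : 1 <= Y.
  have GG1 : 1 <= Gamma * Gamma by rewrite -[leLHS]mulr1 ler_pM.
  rewrite /Y -[leLHS]mulr1 ler_pM// ler_pdivlMr// mul1r (le_trans c1)//.
  exact: exprn_ege1.
split => //.
have lnGamma : ln Gamma <= 1.
  rewrite -ler_expR lnK ?posrE// /Gamma kV.
  have h : 1 + N%:R^-1 <= expR N%:R^-1 :> R by exact: expR_ge1Dx.
  apply: (@le_trans _ _ (expR N%:R^-1 ^+ N)).
    apply: lerXn2r => //; first by rewrite nnegrE addr_ge0// invr_ge0 ltW.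
    by rewrite nnegrE expR_ge0.
  by rewrite -expRM_natl mulfV// gt_eqF.
have lnY : ln Y = ln Gamma + ln Gamma + ln (d%:R ^+ 2) - ln c.
  have GG0 : 0 < Gamma * Gamma by exact: mulr_gt0.
  have dd0 : 0 < d%:R ^+ 2 :> R by exact: exprn_gt0.
  have dc0 : 0 < d%:R ^+ 2 / c by exact: divr_gt0.
  rewrite /Y lnM ?posrE//.
  rewrite [X in X + _]lnM ?posrE//.
  by rewrite ln_div ?posrE//; ring.
have lnc : - ln c = ln (1 + sigma) + ln N%:R - ln sigma.
  by rewrite cE ln_div ?posrE ?mulr_gt0// lnM ?posrE//; ring.
have ln1s : ln (1 + sigma) <= ln 2 by rewrite ler_ln ?posrE//; lra.
have lnk : - ln (1 - k) = ln N.+1%:R by rewrite k1 lnV ?posrE// opprK.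
have lns2 : ln (Num.sqrt 2) = ln 2 / 2 :> R.
  have s2 : 0 < Num.sqrt 2 :> R by rewrite sqrtr_gt0.
  have : ln (Num.sqrt 2 ^+ 2) = ln 2 :> R by rewrite sqr_sqrtr.
  by rewrite lnXn// => <-; rewrite mulr2n; field.
have lnV1s : ln (1 / sigma) = - ln sigma by rewrite div1r lnV ?posrE.
have ln_sigma : ln sigma <= 0 by rewrite ln_le0.
have lnprod : ln (N.+1%:R) + ln (d%:R ^+ 2) + ln N%:R <= 8 * ln n%:R :> R.
  rewrite -!lnM ?posrE ?mulr_gt0 ?exprn_gt0//.
  have -> : 8 * ln n%:R = ln (n%:R ^+ 8) :> R by rewrite lnXn// mulr_natl.
  rewrite ler_ln ?posrE ?mulr_gt0 ?exprn_gt0//.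
  pose x : R := m.+1%:R.
  have x0 : 0 <= x by rewrite ler0n.
  have nE : n%:R = x + 1 :> R by rewrite natr1.
  rewrite NS /N /d !natrM nE -/x -subr_ge0.
  (* In terms of [x = n - 1], the difference [n^8 - (N + 1) d^2 N] factors with nonnegative
     coefficients. *)
  have -> : (x + 1) ^+ 8 -
      ((x + 1) * (x + 1) + 1) * ((x + 1) * x) ^+ 2 * ((x + 1) * (x + 1)) =
      (x + 1) ^+ 4 * (2 * x ^+ 3 + 4 * x ^+ 2 + 4 * x + 1) by ring.
  by rewrite mulr_ge0 ?exprn_ge0 ?addr_ge0 ?mulr_ge0 ?exprn_ge0.
(* The constant 6 splits as [5/2 ln 2 <= 2], [2 ln Gamma <= 2] and [1 + 1]; moreover
   [- ln sigma <= 2 ln (1 / sigma)]. *)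
have := ln2_le; rewrite lnY; lra.
Qed.

End log_constants.

(** Here [x] and [y] stand for the volumes of the cone and the ball, [G] for [Gamma], and
    [G * G * (D / c)] for [Y]: the growth term averages to exactly 1. *)
Lemma normalization_identity (K : fieldType) (C0 x y G D c : K) :
  x != 0 -> y != 0 -> G != 0 -> D != 0 -> c != 0 ->
  x^-1 * (C0 * x + G / y * (G * (D / (G * G * (D / c) * c)) * x * y)) = C0 + 1.
Proof. by move=> x0 y0 G0 D0 c0; field; rewrite x0 y0 G0 D0 c0. Qed.

(** * Mean of the logarithm over the spherical cap *)

Section smoothed_condition.
Variables (R : realType) (m : nat).
Local Notation n := m.+2.
Local Notation d := (n * m.+1)%N.
Implicit Types (A B M Z a : 'M[R]_n) (sigma : R).
Variable F : seq (R * seq ('I_n * 'I_n)).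
Hypothesis Fd : form_degree d F.
Hypothesis FE : forall A, trace_disc A = mx_form F A.
Notation mu := (@lebesgue_mx R n n).
Notation K := (@frob_ball R n).

Let mK : measurable K := @measurable_frob_ball R n.

Let muK_fin : mu K \is a fin_num.
Proof. by rewrite ge0_fin_numE ?measure_ge0// lebesgue_frob_ball_lty. Qed.

Let muK_gt0 : 0 < fine (mu K).
Proof. by rewrite -lte_fin fineK// lebesgue_frob_ball_gt0. Qed.

(** [ln_dist_le_growth] bounds the distance to each point of [multiple_eigen] from below by the same
    positive number, hence also the infimum. *)
Lemma lne_kappa_eigen_le (Y k : R) Z : 0 < Y -> 0 < k < 1 -> frob_norm Z = 1 ->
  (lne (kappa_eigen Z) <=
   (ln (Num.sqrt 2) + ln 2 - ln (1 - k) + ln Y + 1)%:E +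
   (k^-1 ^+ (n * n) / fine (mu K))%:E * \int[mu]_(a in K) mx_growth d F Y Z a)%E.
Proof.
move=> Y0 k01 Z1; have /andP[k0 k1] := k01.
set T := (\int[mu]_(a in K) _)%E.
have c0 : 0 < k^-1 ^+ (n * n) / fine (mu K).
  by rewrite divr_gt0// exprn_gt0// invr_gt0.
have T0 : (0 <= T)%E by apply: integral_ge0 => a _; exact: mx_growth_ge0.
have [->|Ty] := eqVneq T +oo%E; first by rewrite gt0_muley ?lte_fin// addey// leey.
have TE := fineK (_ : T \is a fin_num).
have {}TE : ((fine T)%:E = T)%E by apply: TE; rewrite ge0_fin_numE// lt_neqAle Ty leey.
(* At a zero of the form the growth is [+oo] in every direction, against the finiteness of [T]. *)
have fZ : mx_form F Z != 0.
  apply: contraNneq Ty => fZ; apply/eqP; rewrite /T (eq_integral (cst +oo%E)).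
    by rewrite integral_cst// gt0_mulye// lebesgue_frob_ball_gt0.
  by move=> a _; rewrite mx_growth_zero.
pose C0 := ln (Num.sqrt 2) + ln 2 - ln (1 - k) + ln Y + 1; rewrite -/C0.
set c := _ / _ in c0 *; rewrite -TE -EFinM -EFinD.
pose L := C0 - ln (Num.sqrt 2) + c * fine T.
have far B : multiple_eigen B -> expR (- L) <= frob_norm (Z - B).
  move=> /(multiple_eigen_form0 FE) fB.
  have := ln_dist_le_growth Fd Y0 k01 (ltn0Sn _) fZ fB.
  rewrite -/T -TE -(fineK muK_fin) -!EFinM lee_fin -ler_pdivlMr//.
  rewrite mulrAC -/c => h.
  have ZB0 : 0 < frob_norm (Z - B).
    rewrite lt_neqAle frob_norm_ge0 andbT eq_sym; apply/eqP => /frob_norm_eq0.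
    by move/eqP; rewrite subr_eq0 => /eqP ZB; move: fZ; rewrite ZB fB eqxx.
  rewrite -[leRHS](lnK ZB0) ler_expR /L /C0; lra.
have dist_ge : ((expR (- L))%:E <= frob_dist Z (@multiple_eigen R n))%E.
  by apply: le_ereal_inf_tmp => _ [B BS <-]; rewrite lee_fin far.
have s2 : 0 < Num.sqrt 2 :> R by rewrite sqrtr_gt0.
rewrite /kappa_eigen ifF; last first.
  apply: contraNF fZ => /set_mem /(multiple_eigen_form0 FE) ->; exact: eqxx.
rewrite Z1 mulr1; move: dist_ge; case: (frob_dist _ _) => [r||] //; last first.
  by rewrite invey mule0 /= lexx leNye.
rewrite lee_fin => rL; have r0 : 0 < r := lt_le_trans (expR_gt0 _) rL.
rewrite inver gt_eqF// -EFinM lne_EFin ?divr_gt0// lee_fin ln_div ?posrE//.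
have : - L <= ln r by rewrite -[leLHS]expRK ler_ln ?posrE ?expR_gt0.
by rewrite /L; lra.
Qed.

(** After the exchange of integrals, each direction [a] with nonzero form is covered by
    [integral_mx_growth_le] on the cone, which [frob_cone_contract] maps into itself. The other
    directions form a null set. *)
Lemma integral2_mx_growth_le A sigma (k : R)
    (c := (1 - k) * sigma / (1 + sigma) / k) (Y : R)
    (C := frob_cone A (Num.sqrt (1 - sigma ^+ 2))) :
  frob_norm A = 1 -> 0 < sigma <= 1 -> 0 < k < 1 -> 0 < Y ->
  (\int[mu]_(M in C) \int[mu]_(a in K) mx_growth d F Y M a <=
   (k^-1 ^+ (n * n) * (d%:R ^+ 2 / (Y * c)))%:E * mu C * mu K)%E.
Proof.
move=> A1 s01 k01 Y0; have /andP[s0 s1] := s01; have /andP[k0 k1] := k01.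
have mC : measurable C := measurable_frob_cone _ _.
have c0 : 0 < c.
  by rewrite divr_gt0// divr_gt0 ?addr_gt0// mulr_gt0// subr_gt0.
have muC0 : (0 <= mu C)%E by exact: measure_ge0.
pose g (z : 'M[R]_n * 'M[R]_n) := mx_growth d F Y z.1 z.2.
have mg : measurable_fun setT g.
  by apply: measurable_mx_growth; [exact: measurable_fst|exact: measurable_snd].
have g0 z : (0 <= g z)%E by exact: mx_growth_ge0.
rewrite (@fubini_tonelli_setX _ _ _ _ R mu mu C K g mC mK mg g0).
set N := K `&` [set a | mx_form F a = 0].
have mN : measurable N.
  apply: measurableI; first exact: mK.
  by apply: (measurable_preimageT (measurable_mx_form F) (measurable_set1 0)).
have mI := @measurable_fun_integral_in_swap _ _ _ _ R mu C g mC mg g0.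
have I0 y : (0 <= \int[mu]_(x in C) g (x, y))%E by exact: integral_ge0.
rewrite (@ge0_negligible_integral _ _ _ mu K N)//; last 2 first.
- exact: measurable_funTS.
- exact: (mx_form_null Fd FE).
set b := (_ * mu C)%E.
apply: (@le_trans _ _ (\int[mu]_(a in K `\` N) cst b a)%E).
  apply: ge0_le_integral.
  - exact: measurableD.
  - by move=> a _; exact: I0.
  - exact: measurable_funTS.
  - exact: measurable_cst.
  - move=> a [a1 aN]; have fa : mx_form F a != 0.
      by apply/eqP => fa; apply: aN.
    have contr M (s : R) : C M -> `[(-1)%R, 1%R]%classic s ->
        C (k *: M + (((1 - k) / (1 + sigma)) *: A +
           s *: (((1 - k) * sigma / (1 + sigma)) *: a))).
      move=> CM; rewrite /= in_itv/= => sI.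
      by apply: frob_cone_contract => //; rewrite k0 ltW.
    have := integral_mx_growth_le Fd k0 Y0 (ltn0Sn _) (lt0r_neq0 c0) mC contr _ fa.
    rewrite (gtr0_norm c0); apply.
    (* The final division by [k] in [c] makes [k * c] the radius of the admissible translations of
       the cone. *)
    by congr (_ *: _); rewrite /c; field; rewrite !gt_eqF// addr_gt0.
rewrite integral_cst; last exact: measurableD.
apply: lee_wpmul2l.
  apply: mule_ge0; last exact: muC0.
  rewrite lee_fin; apply: mulr_ge0; first by rewrite exprn_ge0// invr_ge0 ltW.
  apply: divr_ge0; first exact: sqr_ge0.
  by rewrite mulr_ge0// ltW.
apply: le_measure; rewrite ?inE.
- exact: measurableD.
- exact: mK.
- exact: subDsetl.
Qed.

Lemma expectation_lne_kappa_eigen_le A sigma :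
  frob_norm A = 1 -> 0 < sigma <= 1 ->
  (\int[uniform_ball A sigma]_Z lne (kappa_eigen Z) <=
   (8 * ln n%:R + 2 * ln (1 / sigma) + 6)%:E)%E.
Proof.
move=> A1 s01; have /andP[s0 s1] := s01.
have [] := @condition_constants R m sigma s01.
pose N := (n * n)%N; pose k : R := N%:R / N.+1%:R; rewrite -/k.
pose c := (1 - k) * sigma / (1 + sigma) / k; rewrite -/c.
pose Gamma := k^-1 ^+ N; rewrite -/Gamma.
pose D : R := d%:R ^+ 2; rewrite -/D.
pose Y := Gamma * Gamma * (D / c); rewrite -/Y.
pose C0 := ln (Num.sqrt 2) + ln 2 - ln (1 - k) + ln Y + 1; rewrite -/C0.
move=> Y1 bound; have Y0 : 0 < Y := lt_le_trans ltr01 Y1.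
have N0 : 0 < N%:R :> R by rewrite ltr0n.
have k0 : 0 < k by rewrite divr_gt0 ?ltr0n.
have k1 : k < 1 by rewrite ltr_pdivrMr ?ltr0n// mul1r ltr_nat.
have k01 : 0 < k < 1 by rewrite k0.
have c0 : 0 < c.
  by rewrite divr_gt0// divr_gt0 ?addr_gt0// mulr_gt0// subr_gt0.
have Gamma0 : 0 < Gamma by rewrite exprn_gt0// invr_gt0.
have D0 : 0 < D by rewrite exprn_gt0// ltr0n.
have C0_ge0 : 0 <= C0.
  have : 0 <= ln (Num.sqrt 2) :> R.
    by rewrite ln_ge0// -[leLHS]sqrtr1 ler_sqrt// ler1n.
  have : 0 <= ln 2 :> R by rewrite ln_ge0// ler1n.
  have : ln (1 - k) <= 0 by rewrite ln_le0// lerBlDr lerDl ltW.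
  have := ln_ge0 Y1; rewrite /C0; lra.
pose I Z := (\int[mu]_(a in K) mx_growth d F Y Z a)%E.
have I0 Z : (0 <= I Z)%E by apply: integral_ge0 => a _; exact: mx_growth_ge0.
have mI : measurable_fun setT I.
  apply: (@measurable_fun_integral_in _ _ _ _ R mu K
    (fun z : 'M[R]_n * 'M[R]_n => mx_growth d F Y z.1 z.2) mK).
    by apply: measurable_mx_growth; [exact: measurable_fst|exact: measurable_snd].
  by move=> z; exact: mx_growth_ge0.
pose c' := Gamma / fine (mu K).
have c'0 : 0 < c' by exact: divr_gt0.
pose H Z := (C0%:E + c'%:E * I Z)%E.
have H0 Z : (0 <= H Z)%E.
  by apply: adde_ge0; [rewrite lee_fin|rewrite mule_ge0// lee_fin ltW].
have mH : measurable_fun setT H.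
  by apply: emeasurable_funD; [exact: measurable_cst|exact: measurable_funeM].
(* A measurable majorant of the logarithm: [H] bounds it on the sphere only, whence the value [+oo]
   elsewhere. *)
pose G Z := if frob_norm Z == 1 then H Z else +oo%E.
have G0 Z : (0 <= G Z)%E by rewrite /G; case: ifP.
have mG : measurable_fun setT G.
  apply: measurable_fun_ifT; [|exact: mH|exact: measurable_cst].
  by apply: measurable_fun_eqr; [exact: measurable_frob_norm|exact: measurable_cst].
pose C := frob_cone A (Num.sqrt (1 - sigma ^+ 2)).
have mC : measurable C := measurable_frob_cone _ _.
have muC_fin : mu C \is a fin_num by exact: lebesgue_frob_cone_fin.
have muC0 : 0 < fine (mu C).
  by rewrite -lte_fin fineK//; exact: lebesgue_frob_cone_gt0.
apply: (@le_trans _ _ (\int[uniform_ball A sigma]_Z G Z)%E).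
  apply: ge0_le_integral_sup => Z; first by rewrite lne_ge0; exact: kappa_eigen_ge1.
  rewrite /G; case: ifPn => [/eqP Z1|_]; last exact: leey.
  exact: lne_kappa_eigen_le.
rewrite (ge0_integral_uniform_ball _ A1 s01 mG G0)// -/C.
(* Points of the cone have norm at most 1, so by [mx_growth_scale] the growth at the projection is
   at most that at the point itself. *)
have GH : (\int[mu]_(M in C) G (sphere_proj M) <= \int[mu]_(M in C) H M)%E.
  apply: ge0_le_integral.
  - exact: mC.
  - by move=> M _; exact: G0.
  - apply: measurable_funTS.
    exact: (measurableT_comp mG (@measurable_sphere_proj R n)).
  - exact: measurable_funTS.
  - move=> M; rewrite /C -(frob_cone_sphere_ball A1 s01) => -[M01 [pM1 _]].
    rewrite /G pM1 eqxx; apply: leeD2l; apply: lee_wpmul2l.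
      by rewrite lee_fin ltW.
    apply: ge0_le_integral.
    + exact: mK.
    + by move=> a _; exact: mx_growth_ge0.
    + by apply: measurable_funTS; apply: measurable_mx_growth;
        [exact: measurable_cst|exact: measurable_id].
    + by apply: measurable_funTS; apply: measurable_mx_growth;
        [exact: measurable_cst|exact: measurable_id].
    + by move=> a _; exact: mx_growth_scale.
have HE : (\int[mu]_(M in C) H M =
    C0%:E * mu C + c'%:E * \int[mu]_(M in C) I M)%E.
  have mIC : measurable_fun C I by exact: measurable_funTS.
  have c'e0 : (0 <= c'%:E)%E by rewrite lee_fin ltW.
  rewrite (@ge0_integralD _ _ _ mu C mC (cst C0%:E) (fun M => c'%:E * I M)%E).
  - by rewrite integral_cst// (ge0_integralZl mu mC mIC (fun M _ => I0 M) c'e0).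
  - by move=> M _; rewrite lee_fin.
  - exact: measurable_cst.
  - by move=> M _; exact: mule_ge0.
  - exact: measurable_funeM.
have II := integral2_mx_growth_le A1 s01 k01 Y0.
rewrite -/c -/Gamma -/D -/C in II.
have c'II := lee_wpmul2l (ltW c'0 : (0 <= c'%:E)%E) II.
apply: (@le_trans _ _ ((fine (mu C))^-1%:E * (C0%:E * mu C +
    c'%:E * ((Gamma * (D / (Y * c)))%:E * mu C * mu K)))%E).
  apply: lee_wpmul2l; first by rewrite lee_fin invr_ge0 ltW.
  by apply: (le_trans GH); rewrite HE leeD2l.
pose x := fine (mu C); pose y := fine (mu K); pose g := Gamma * (D / (Y * c)).
have xE : mu C = x%:E := esym (fineK muC_fin).
have yE : mu K = y%:E := esym (fineK muK_fin).
rewrite -/x -/g xE yE.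
apply: (@le_trans _ _ (x^-1 * (C0 * x + c' * (g * x * y)))%:E); first by [].
rewrite lee_fin; apply: le_trans bound; rewrite le_eqVlt; apply/orP; left; apply/eqP.
exact: (normalization_identity C0 (lt0r_neq0 muC0) (lt0r_neq0 muK_gt0)
  (lt0r_neq0 Gamma0) (lt0r_neq0 D0) (lt0r_neq0 c0)).
Qed.

End smoothed_condition.

Theorem proposition4p3 (R : realType) (n : nat) (sigma : R)
    (n_ge1 : (1 <= n)%N) (sigma_gt0 : 0 < sigma) (sigma_le1 : sigma <= 1) :
  (ereal_sup [set \int[uniform_ball A sigma]_Z lne (kappa_eigen Z)
               | A in @frob_sphere R n]
   <= (8 * ln n%:R + 2 * ln (1 / sigma) + 6)%:E)%E.
Proof.
apply: ge_ereal_sup => _ [A A1 <-].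
case: n n_ge1 A A1 => // -[|m] _ A A1; last first.
  have [F Fd FE] := @trace_disc_form R m.+1.
  by apply: (expectation_lne_kappa_eigen_le Fd FE) => //; rewrite sigma_gt0.
(* In size 1 the characteristic polynomial has degree 1 and no multiple root. *)
have noS : @multiple_eigen R 1 = set0.
  apply/seteqP; split => // B [x].
  rewrite mup_geq ?monic_neq0 ?char_poly_monic// => /dvdp_leq.
  rewrite monic_neq0 ?char_poly_monic// => /(_ isT).
  by rewrite size_exp_XsubC size_char_poly.
(* The distance to the empty set is [+oo], so the condition number is 0 and its logarithm [-oo], as
   is the mean. *)
rewrite (eq_integral (cst -oo%E)); last first.
  move=> Z _; rewrite /kappa_eigen noS ifF; last by rewrite in_set0.
  by rewrite /frob_dist image_set0 ereal_inf0 invey mule0 /= lexx.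
rewrite integral_cst// (_ : _ [set: _] = 1%E); last exact: probability_setT.
by rewrite mule1 leNye.
Qed.
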